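(* Let $G$ be a group. If $B=\bigoplus_{t\in G}B_t$ is a partially-strongly-graded algebra, then $(B\#G)\rtimes_{\beta^B}G$ and $I^B\rtimes_{\gamma^B}G$ are graded-equivalent.
   Context: Algebras are associative, not necessarily unital, over a fixed commutative associative unital ring $k$; $G$ is an arbitrary group. Products of subsets such as $UV$ denote the $k$-span of all products $uv$. An algebra $A$ is idempotent if $A^2=A$. A $G$-graded algebra $B=\bigoplus_tB_t$ ($B_sB_t\subseteq B_{st}$) is partially-strongly-graded if $B_t=B_tB_{t^{-1}}B_t$ for all $t\in G$. A bimodule ${}_RM_S$ is unital if $RM=M=MS$. Smash product: $B\#G:=\bigoplus_{r,s\in G}B_{r^{-1}s}e_{r,s}$, a subalgebra of the algebra of $G\times G$-matrices over $B$ with finitely many nonzero entries ($b\,e_{r,s}$ has $b$ at position $(r,s)$ and $0$ elsewhere). The action $\beta^B$ of $G$ on $B\#G$ is $\beta^B_t(b\,e_{r,s})=b\,e_{tr,ts}$. The partial smash product is the two-sided ideal $I^B:=\bigoplus_{r,s\in G}B_{r^{-1}}B_se_{r,s}$ of $B\#G$. For $B$ partially-strongly-graded, $I:=I^B$ is idempotent and $I\beta^B_t(I)=\beta^B_t(I)I$ for all $t$; the canonical partial action $\gamma^B$ of $G$ on $I^B$ is the product partial action with domains $I_t:=I\beta^B_t(I)$ and isomorphisms $\gamma^B_t:=\beta^B_t|_{I_{t^{-1}}}:I_{t^{-1}}\to I_t$. A product partial action $\alpha$ of $G$ on an algebra $A$ is a family of two-sided ideals $D_t$ of $A$ and algebra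 isomorphisms $\alpha_t:D_{t^{-1}}\to D_t$ such that for all $s,t\in G$: (1) $\alpha_1=\mathrm{id}_A$; (2) $D_t^2=D_t$, $D_sD_t=D_tD_s$; (3) $\alpha_s(D_{s^{-1}}D_t)=D_sD_{st}$; (4) $\alpha_s(\alpha_t(x))=\alpha_{st}(x)$ for $x\in D_{t^{-1}}D_{(st)^{-1}}$. Its skew group algebra is $A\rtimes_\alpha G=\bigoplus_tD_t\delta_t$ with $(a\delta_r)(b\delta_s)=\alpha_r(\alpha_r^{-1}(a)b)\delta_{rs}$, $G$-graded with $D_t\delta_t$ in degree $t$ (for a global action all $D_t=A$). A Morita context $(A,B,X,Y,\tau_A,\tau_B)$ consists of algebras $A,B$, an $(A,B)$-bimodule $X$, a $(B,A)$-bimodule $Y$, an $A$-bimodule map $\tau_A:X\otimes_BY\to A$ and a $B$-bimodule map $\tau_B:Y\otimes_AX\to B$ with $\tau_A(x\otimes y)x'=x\tau_B(y\otimes x')$ and $\tau_B(y\otimes x)y'=y\tau_A(x\otimes y')$. It is a graded Morita context between idempotent $G$-graded algebras $A,B$ if $X=\bigoplus_tX_t$, $Y=\bigoplus_tY_t$ are $G$-graded bimodules, and $\tau_A(X_r\otimes_B Y_s)\subseteq A_{rs}$, $\tau_B(Y_r\otimes_A X_s)\subseteq B_{rs}$ for all $r,s\in G$. Two idempotent $G$-graded algebras are graded-equivalent if there is a graded Morita context between them with unital bimodules $X,Y$ and surjective $\tau_A,\tau_B$. *)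

(* Defs.v *)
From HB Require Import structures.
From mathcomp Require Import all_boot all_order all_algebra finmap.
From mathcomp Require Import boolp classical_sets functions cardinality fsbigop.

Set Implicit Arguments.
Unset Strict Implicit.
Unset Printing Implicit Defensive.
Import GRing.Theory.
Local Open Scope classical_set_scope.
Local Open Scope ring_scope.

Section Submodules.
Context {k : pzRingType} {V : lmodType k}.
Implicit Types (S : set V) (x y : V).

Definition submodule S :=
  S 0 /\ forall (c : k) x y, S x -> S y -> S (c *: x + y).

Definition lspan S : set V := smallest submodule S.

Lemma submodule0 S : submodule S -> S 0. Proof. by case. Qed.

Lemma submoduleZ S (c : k) x : submodule S -> S x -> S (c *: x).
Proof. by move=> [S0 SL] Sx; rewrite -[_ *: _]addr0; exact: SL. Qed.

Lemma submoduleD S x y : submodule S -> S x -> S y -> S (x + y).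
Proof. by move=> [S0 SL] Sx; rewrite -[x]scale1r; exact: SL. Qed.

Lemma submoduleN S x : submodule S -> S x -> S (- x).
Proof. by move=> HS Sx; rewrite -scaleN1r; exact: submoduleZ. Qed.

Lemma submodule_sum S (I : Type) (r : seq I) (F : I -> V) :
  submodule S -> (forall i, S (F i)) -> S (\sum_(i <- r) F i).
Proof.
move=> HS SF; elim/big_ind: _ => //; first exact: submodule0.
by move=> x y; exact: submoduleD.
Qed.

Lemma submoduleT : submodule [set: V]. Proof. by []. Qed.

Lemma submodule_lspan S : submodule (lspan S).
Proof.
split=> [M [[M0 _] _]//|c x y Sx Sy M [HM SM]].
by apply: HM.2; [exact: Sx|exact: Sy].
Qed.

Lemma sub_lspan S : S `<=` lspan S.
Proof. exact: sub_gen_smallest. Qed.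

Lemma lspan_sub S M : submodule M -> S `<=` M -> lspan S `<=` M.
Proof. exact: smallest_sub. Qed.

Lemma lspan_ind S (P : V -> Prop) :
  P 0 -> (forall (c : k) x y, P x -> P y -> P (c *: x + y)) ->
  (forall x, S x -> P x) -> forall x, lspan S x -> P x.
Proof. by move=> P0 PL SP; apply: (@lspan_sub S P) => //; split. Qed.

Section Subtype.
Context {S : set V} (HS : submodule S).

Definition in_submodule of submodule S : {pred V} := [pred x | x \in S].

Fact in_submodule_closed : GRing.subsemimod_closed (in_submodule HS).
Proof.
split; first split.
- by rewrite inE; exact: submodule0.
- by move=> x y /[!inE]; exact: submoduleD.
- by move=> c x /[!inE]; exact: submoduleZ.
Qed.
HB.instance Definition _ :=
  GRing.isSubmodClosed.Build k V (in_submodule HS) in_submodule_closed.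

Record subm := Subm { subm_val : V; _ : subm_val \in in_submodule HS }.
HB.instance Definition _ := [isSub for subm_val].
HB.instance Definition _ := [Choice of subm by <:].
HB.instance Definition _ := [SubChoice_isSubLmodule of subm by <:].

Lemma submP (x : subm) : S (val x).
Proof. by have := valP x; rewrite inE. Qed.

Definition mksub (x : V) (Sx : S x) : subm := Subm (mem_set Sx).
End Subtype.


Section QuotientModule.
Context {N : set V} (HN : submodule N).
Local Open Scope quotient_scope.

(* The library's quotient group, to which we add the scalar action. *)
Definition quotm := Quotient.quot (in_submodule HN).
HB.instance Definition _ := Choice.on quotm.
HB.instance Definition _ := GRing.Zmodule.on quotm.

Definition qpi (x : V) : quotm := \pi_quotm x.

Lemma qpi_eq x y : qpi x = qpi y <-> N (x - y).
Proof.
have -> : N (x - y) <-> x == y %[mod quotm].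
  by rewrite -Quotient.idealrBE inE.
by split=> /eqP.
Qed.

Lemma qpi_repr (q : quotm) : qpi (repr q) = q.
Proof. exact: reprK. Qed.

Lemma qpiD x y : qpi (x + y) = qpi x + qpi y.
Proof. exact: Quotient.pi_add. Qed.

Definition qscale (c : k) (q : quotm) : quotm := qpi (c *: repr q).

Lemma qpiZ c x : qpi (c *: x) = qscale c (qpi x).
Proof.
apply/qpi_eq; rewrite -scalerBr; apply: submoduleZ => //.
by apply/qpi_eq; rewrite qpi_repr.
Qed.

Fact qscaleA a b q : qscale a (qscale b q) = qscale (a * b) q.
Proof. by rewrite -(qpi_repr q) -!qpiZ scalerA. Qed.
Fact qscale1 : left_id 1 qscale.
Proof. by move=> q; rewrite -(qpi_repr q) -qpiZ scale1r. Qed.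
Fact qscaleDr : right_distributive qscale +%R.
Proof.
move=> a q q'; rewrite -(qpi_repr q) -(qpi_repr q').
by rewrite -!(qpiZ, qpiD) scalerDr.
Qed.
Fact qscaleDl q : {morph qscale^~ q : a b / a + b}.
Proof. by move=> a b; rewrite -(qpi_repr q) -!(qpiZ, qpiD) scalerDl. Qed.
HB.instance Definition _ := GRing.Zmodule_isLmodule.Build k quotm
  qscaleA qscale1 qscaleDr qscaleDl.

Fact qpi_linear : linear qpi.
Proof. by move=> c x y; rewrite qpiD qpiZ. Qed.
HB.instance Definition _ := GRing.isLinear.Build k V quotm *:%R qpi qpi_linear.

End QuotientModule.
End Submodules.

Section FinitelySupported.
Context {k : pzRingType} (T : choiceType) (V : lmodType k).

Definition fin_supp : set (T -> V) :=
  [set f | finite_set (f @^-1` [set~ 0])].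

Lemma fin_supp_submodule : submodule fin_supp.
Proof.
split=> [|c f g ff fg].
  by apply: (sub_finite_set _ (finite_set0 T)) => t /= /(_ erefl).
have : finite_set (f @^-1` [set~ 0] `|` g @^-1` [set~ 0]).
  by rewrite finite_setU.
apply: sub_finite_set => t /= ft.
apply: contrapT => /not_orP[/contrapT f0 /contrapT g0].
by apply: ft; rewrite !fctE f0 g0 scaler0 addr0.
Qed.

(* Finitely supported families indexed by T, i.e., the direct sum of T copies *)
(* of V.                                                                      *)
Definition fs := subm fin_supp_submodule.
HB.instance Definition _ := GRing.Lmodule.on fs.

Definition fs_fun (f : fs) : T -> V := val f.
Coercion fs_fun : fs >-> Funclass.

Definition mkfs (f : T -> V) (Hf : fin_supp f) : fs :=
  mksub fin_supp_submodule Hf.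

Lemma fsP (f g : fs) : (forall t, f t = g t) <-> f = g.
Proof. by split=> [fg|->//]; apply: val_inj; apply/funext. Qed.

Lemma fs0E t : (0 : fs) t = 0. Proof. by []. Qed.
Lemma fsDE (f g : fs) t : (f + g : fs) t = f t + g t. Proof. by []. Qed.
Lemma fsZE c (f : fs) t : (c *: f : fs) t = c *: f t. Proof. by []. Qed.
Lemma fs_sumE I (r : seq I) (F : I -> fs) t :
  (\sum_(i <- r) F i : fs) t = \sum_(i <- r) F i t.
Proof. by elim/big_rec2: _ => //= i y x _ <-. Qed.

Lemma fs_finite (f : fs) : finite_set (f @^-1` [set~ 0]).
Proof. exact: (submP f). Qed.

Lemma single_subproof (t : T) (v : V) :
  fin_supp (fun t' => if t' == t then v else 0).
Proof.
apply: (sub_finite_set _ (finite_set1 t)) => t' /=.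
by case: eqVneq => //= _ /(_ erefl).
Qed.

Definition single (t : T) (v : V) : fs := mkfs (single_subproof t v).

Lemma singleE t v t' : single t v t' = if t' == t then v else 0.
Proof. by []. Qed.
Lemma single_at t v : single t v t = v.
Proof. by rewrite singleE eqxx. Qed.
Lemma single_linear t : linear (single t).
Proof.
move=> c u v; apply/fsP => t'; rewrite fsDE fsZE !singleE.
by case: eqP => // _; rewrite scaler0 addr0.
Qed.
HB.instance Definition _ t :=
  GRing.isLinear.Build k V fs *:%R (single t) (single_linear t).

Lemma fs_decomp (f : fs) : exists2 r : seq T, uniq r &
  (forall t, t \notin r -> f t = 0) /\ f = \sum_(t <- r) single t (f t).
Proof.
have [X XE] := finite_fsetP.1 (fs_finite f).
have f0 t : t \notin X -> f t = 0.
  move=> tX; apply: contrapT => ft; move/negP: tX; apply.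
  have : [set` X] t by rewrite -XE.
  by [].
exists (enum_fset X); first exact: fset_uniq.
split=> //; apply/fsP => t; rewrite fs_sumE.
have [tX|tX] := boolP (t \in X); last first.
  rewrite f0// big_seq big1// => t' t'X; rewrite singleE.
  by case: eqP t'X tX => // <- ->.
rewrite (bigD1_seq t) ?fset_uniq//= single_at big1 ?addr0// => t' t't.
by rewrite singleE eq_sym (negPf t't).
Qed.

Lemma fs_ind (D : T -> set V) (P : fs -> Prop) : (forall t, submodule (D t)) ->
  P 0 ->
  (forall f g : fs, (forall t, D t (f t)) -> (forall t, D t (g t)) ->
     P f -> P g -> P (f + g)) ->
  (forall t v, D t v -> P (single t v)) ->
  forall f : fs, (forall t, D t (f t)) -> P f.
Proof.
move=> DS P0 PD P1 f Df; have [r _ [_ fE]] := fs_decomp f.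
suff [] : (forall t, D t ((\sum_(t <- r) single t (f t) : fs) t)) /\
          P (\sum_(t <- r) single t (f t)) by rewrite -fE.
elim/big_ind: _ => [|x y [Dx Px] [Dy Py]|t _]; split.
- by move=> t; exact: submodule0.
- exact: P0.
- by move=> t; exact: submoduleD.
- exact: PD.
- by move=> t'; rewrite singleE; case: eqP => [->//|_]; exact: submodule0.
- exact: P1.
Qed.

Section Sum.
Context {W : lmodType k} (phi : T -> V -> W).
Hypothesis phi0 : forall t, phi t 0 = 0.

Definition fs_sum (f : fs) : W := \sum_(t \in [set: T]) phi t (f t).

Lemma fs_sum_seq (f : fs) (A : {fset T}) :
  (forall t, t \notin A -> f t = 0) -> fs_sum f = \sum_(t <- A) phi t (f t).
Proof. by move=> fA; apply: fsbigTE => t /fA ->; exact: phi0. Qed.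

Lemma fs_supp (f : fs) : exists A : {fset T}, forall t, t \notin A -> f t = 0.
Proof.
have [r _ [f0 _]] := fs_decomp f.
by exists [fset x in r]%fset => t; rewrite inE => /f0.
Qed.

Lemma fs_sum_linear c (f g : fs) :
  (forall t, phi t (c *: f t + g t) = c *: phi t (f t) + phi t (g t)) ->
  fs_sum (c *: f + g) = c *: fs_sum f + fs_sum g.
Proof.
move=> phiL; have [A fA] := fs_supp f; have [B gB] := fs_supp g.
have {}fA t : t \notin (A `|` B)%fset -> f t = 0.
  by rewrite inE negb_or => /andP[/fA].
have {}gB t : t \notin (A `|` B)%fset -> g t = 0.
  by rewrite inE negb_or => /andP[_ /gB].
rewrite (fs_sum_seq fA) (fs_sum_seq gB) (@fs_sum_seq _ (A `|` B)%fset).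
  by rewrite scaler_sumr -big_split; apply: eq_bigr => t _; exact: phiL.
by move=> t tAB; rewrite fsDE fsZE fA// gB// scaler0 addr0.
Qed.

Lemma fs_sum0 : fs_sum 0 = 0.
Proof. by apply: fsbig1 => t _; exact: phi0. Qed.

Lemma fs_sum_single t v : fs_sum (single t v) = phi t v.
Proof.
rewrite (@fs_sum_seq _ [fset t]%fset) ?big_seq_fset1 ?single_at//.
by move=> t'; rewrite inE singleE => /negPf ->.
Qed.

Lemma fs_sum_in (S : set W) (f : fs) :
  submodule S -> (forall t, S (phi t (f t))) -> S (fs_sum f).
Proof.
move=> HS Sf; have [A fA] := fs_supp f.
by rewrite (fs_sum_seq fA); exact: submodule_sum.
Qed.
End Sum.

End FinitelySupported.
Arguments single {k T V}.

Definition direct_sum (k : pzRingType) (T : choiceType) (V : lmodType k)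
    (V_ : T -> set V) : Prop :=
  (forall t, submodule (V_ t)) /\
  forall v, exists! f : fs T V,
    (forall t, V_ t (f t)) /\ v = \sum_(t \in [set: T]) f t.

(* Associative, not necessarily unital, k-algebras. *)
HB.mixin Record Lmodule_isNUAlgebra (k : comPzRingType) A
    of GRing.Lmodule k A := {
  amul : A -> A -> A;
  amulA : associative amul;
  amulDl : left_distributive amul +%R;
  amulDr : right_distributive amul +%R;
  amulZl : forall (c : k) x y, amul (c *: x) y = c *: amul x y;
  amulZr : forall (c : k) x y, amul x (c *: y) = c *: amul x y
}.

#[short(type="nuAlgType")]
HB.structure Definition NUAlgebra (k : comPzRingType) :=
  {A of Lmodule_isNUAlgebra k A & GRing.Lmodule k A}.

Notation "x *a y" := (amul x y) (at level 40, left associativity) : ring_scope.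

(* The product UV of two subsets of an algebra: the span of the products uv. *)
Definition sprod (k : comPzRingType) (A : nuAlgType k) (U V : set A) : set A :=
  lspan [set u *a v | u in U & v in V].

Notation "U *s V" := (sprod U V) (at level 40, left associativity) :
  classical_set_scope.

Section AlgebraTheory.
Context {k : comPzRingType} {A : nuAlgType k}.
Implicit Types (x y : A) (U V W S : set A).

Lemma amul0l x : 0 *a x = 0.
Proof. by rewrite -[X in X *a _](scale0r (0 : A)) amulZl scale0r. Qed.
Lemma amul0r x : x *a 0 = 0.
Proof. by rewrite -[X in _ *a X](scale0r (0 : A)) amulZr scale0r. Qed.
Lemma amul_suml I (r : seq I) (F : I -> A) y :
  (\sum_(i <- r) F i) *a y = \sum_(i <- r) (F i *a y).
Proof. by elim/big_rec2: _ => [|i a b _ <-]; rewrite ?amul0l ?amulDl. Qed.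
Lemma amul_sumr I (r : seq I) (F : I -> A) y :
  y *a (\sum_(i <- r) F i) = \sum_(i <- r) (y *a F i).
Proof. by elim/big_rec2: _ => [|i a b _ <-]; rewrite ?amul0r ?amulDr. Qed.

Lemma submodule_sprod U V : submodule (U *s V).
Proof. exact: submodule_lspan. Qed.

Lemma mem_sprod U V x y : U x -> V y -> (U *s V) (x *a y).
Proof. by move=> Ux Vy; apply: sub_lspan; exists x => //; exists y. Qed.

Lemma sprod_sub U V S : submodule S ->
  (forall x y, U x -> V y -> S (x *a y)) -> U *s V `<=` S.
Proof. by move=> HS SUV; apply: lspan_sub => // _ [x Ux [y Vy <-]]; exact: SUV. Qed.

Lemma sprodS U U' V V' : U `<=` U' -> V `<=` V' -> U *s V `<=` U' *s V'.
Proof.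
move=> UU VV; apply: sprod_sub => [|x y /UU Ux /VV Vy]; first exact: submodule_sprod.
exact: mem_sprod.
Qed.

Lemma submodule_mull x S : submodule S -> submodule [set y | S (x *a y)].
Proof.
move=> HS; split=> /= [|c y z]; first by rewrite amul0r; exact: submodule0.
by rewrite amulDr amulZr; exact: HS.2.
Qed.
Lemma submodule_mulr y S : submodule S -> submodule [set x | S (x *a y)].
Proof.
move=> HS; split=> /= [|c x z]; first by rewrite amul0l; exact: submodule0.
by rewrite amulDl amulZl; exact: HS.2.
Qed.

Lemma sprodA U V W : U *s (V *s W) = U *s V *s W.
Proof.
have HS := submodule_sprod; apply/seteqP; split; apply: sprod_sub => //.
- move=> x y Ux; move: y; apply: sprod_sub => [|y z Vy Wz].
    exact: submodule_mull.
  by rewrite /= amulA; do 2?apply: mem_sprod.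
- move=> x z + Wz; move: x; apply: sprod_sub => [|x y Ux Vy].
    exact: submodule_mulr.
  by rewrite /= -amulA; do 2?apply: mem_sprod.
Qed.

Definition idem_set S : Prop := S *s S = S.

Definition ideal S : Prop :=
  submodule S /\ forall x y, S x -> S (x *a y) /\ S (y *a x).

Definition subalgebra S : Prop :=
  submodule S /\ forall x y, S x -> S y -> S (x *a y).

Lemma ideal_subalgebra S : ideal S -> subalgebra S.
Proof. by move=> [HS SM]; split=> // x y Sx _; exact: (SM x y Sx).1. Qed.

Lemma ideal_sprod U V : ideal U -> ideal V -> ideal (U *s V).
Proof.
move=> [HU UM] [HV VM]; split=> [|x y]; first exact: submodule_sprod.
move: x; apply: sprod_sub => [|u v Uu Vv].
  split=> /= [|c x z].
    by rewrite amul0l amul0r; split; exact: submodule0 (submodule_sprod _ _).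
  rewrite amulDl amulDr amulZl amulZr => -[h1 h2] [h3 h4].
  by split; apply: (submodule_sprod _ _).2.
split; first by rewrite -amulA; apply: mem_sprod => //; exact: (VM v y Vv).1.
by rewrite amulA; apply: mem_sprod => //; exact: (UM u y Uu).2.
Qed.

Section Subalgebra.
Context {S : set A} (HS : subalgebra S).

Definition subalg := subm HS.1.
HB.instance Definition _ := SubType.on subalg.
HB.instance Definition _ := GRing.Lmodule.on subalg.

Definition subalg_mul (x y : subalg) : subalg :=
  mksub HS.1 (HS.2 _ _ (submP x) (submP y)).

Fact subalg_mulA : associative subalg_mul.
Proof. by move=> x y z; apply: val_inj; exact: amulA. Qed.
Fact subalg_mulDl : left_distributive subalg_mul +%R.
Proof. by move=> x y z; apply: val_inj; exact: amulDl. Qed.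
Fact subalg_mulDr : right_distributive subalg_mul +%R.
Proof. by move=> x y z; apply: val_inj; exact: amulDr. Qed.
Fact subalg_mulZl (c : k) (x y : subalg) : subalg_mul (c *: x) y = c *: subalg_mul x y.
Proof. by apply: val_inj; exact: amulZl. Qed.
Fact subalg_mulZr (c : k) (x y : subalg) : subalg_mul x (c *: y) = c *: subalg_mul x y.
Proof. by apply: val_inj; exact: amulZr. Qed.
HB.instance Definition _ := Lmodule_isNUAlgebra.Build k subalg
  subalg_mulA subalg_mulDl subalg_mulDr subalg_mulZl subalg_mulZr.

Definition sval_alg (x : subalg) : A := val x.

Lemma svalM (x y : subalg) : sval_alg (x *a y) = sval_alg x *a sval_alg y.
Proof. by []. Qed.
Lemma svalL c (x y : subalg) :
  sval_alg (c *: x + y) = c *: sval_alg x + sval_alg y.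
Proof. by []. Qed.
Lemma sval_inj : injective sval_alg. Proof. exact: val_inj. Qed.
Lemma svalP (x : subalg) : S (sval_alg x). Proof. exact: (submP x). Qed.
Definition mkalg (x : A) (Sx : S x) : subalg := mksub HS.1 Sx.
Lemma mkalgE x (Sx : S x) : sval_alg (mkalg Sx) = x. Proof. by []. Qed.

End Subalgebra.
End AlgebraTheory.

Section Homomorphisms.
Context {k : comPzRingType} {A B : nuAlgType k}.

Definition alg_hom (f : A -> B) : Prop := linear f /\ {morph f : x y / x *a y}.

Lemma image_submodule (f : A -> B) (S : set A) :
  linear f -> submodule S -> submodule (f @` S).
Proof.
move=> fL HS; split=> [|c _ _ [x Sx <-] [y Sy <-]].
  exists 0; first exact: submodule0.
  by have := fL (-1) 0 0; rewrite scaler0 add0r scaleN1r addNr.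
by exists (c *: x + y); [exact: HS.2|exact: fL].
Qed.

Lemma preim_submodule (f : A -> B) (S : set B) :
  linear f -> submodule S -> submodule (f @^-1` S).
Proof.
move=> fL HS; split=> [|c x y Sx Sy] /=; last by rewrite fL; exact: HS.2.
by have := fL (-1) 0 0; rewrite scaler0 add0r scaleN1r addNr => ->; exact: submodule0.
Qed.

Lemma image_sprod (f : A -> B) (U V : set A) : alg_hom f ->
  f @` (U *s V) = (f @` U) *s (f @` V).
Proof.
move=> [fL fM]; apply/seteqP; split.
  move=> _ [x + <-]; move: x; apply: sprod_sub.
    exact: (preim_submodule fL (submodule_sprod _ _)).
  by move=> x y Ux Vy; rewrite fM; apply: mem_sprod; [exists x|exists y].
apply: sprod_sub; first exact: image_submodule (submodule_sprod _ _).
by move=> _ _ [x Ux <-] [y Vy <-]; exists (x *a y); [exact: mem_sprod|].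
Qed.

End Homomorphisms.

(* T x T-matrices with finitely many nonzero entries. *)
Section FiniteMatrices.
Context {k : comPzRingType} (T : choiceType) (A : nuAlgType k).

Definition fmat := fs (T * T)%type A.
Identity Coercion fmat_fs : fmat >-> fs.
HB.instance Definition _ := GRing.Lmodule.on fmat.
Implicit Types a b c : fmat.

Lemma fmat_supp a : exists X : {fset T},
  forall r s, (r \notin X) || (s \notin X) -> a (r, s) = 0.
Proof.
have [Y aY] := fs_supp a.
exists ([fset p.1 | p in Y] `|` [fset p.2 | p in Y])%fset => r s rs.
apply: aY; apply: contraTN rs => pY; rewrite negb_or !negbK !inE.
apply/andP; split; apply/orP; [left|right].
  by apply/imfsetP; exists (r, s).
by apply/imfsetP; exists (r, s).
Qed.

Lemma fmat_supp2 a b : exists X : {fset T},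
  (forall r s, (r \notin X) || (s \notin X) -> a (r, s) = 0) /\
  (forall r s, (r \notin X) || (s \notin X) -> b (r, s) = 0).
Proof.
have [X aX] := fmat_supp a; have [Y bY] := fmat_supp b.
exists (X `|` Y)%fset; split=> r s; rewrite !inE !negb_or => rs.
  by apply: aX; case/orP: rs => /andP[-> _]; rewrite ?orbT.
by apply: bY; case/orP: rs => /andP[_ ->]; rewrite ?orbT.
Qed.

Definition fmat_mul_fun a b (p : T * T) : A :=
  \sum_(u \in [set: T]) (a (p.1, u) *a b (u, p.2)).

Lemma fmat_mul_seq a b (X : {fset T}) p :
  (forall r s, s \notin X -> a (r, s) = 0) ->
  fmat_mul_fun a b p = \sum_(u <- X) (a (p.1, u) *a b (u, p.2)).
Proof. by move=> aX; apply: fsbigTE => u /aX ->; rewrite amul0l. Qed.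

Lemma fmat_mul_subproof a b : fin_supp (fmat_mul_fun a b).
Proof.
have [X [aX bX]] := fmat_supp2 a b.
apply: (sub_finite_set _ (finite_fset (X `*` X)%fset)) => -[r s] /= ab0.
rewrite inE /=; apply: contraPT ab0; rewrite negb_and /= => rs; apply.
rewrite (@fmat_mul_seq _ _ X) => [|r' s' s'X]; last first.
  by rewrite aX// s'X orbT.
rewrite big1// => u _ /=; case/orP: rs => H; first by rewrite aX ?H// amul0l.
by rewrite bX ?H ?orbT// amul0r.
Qed.

Definition fmat_mul a b : fmat := mkfs (fmat_mul_subproof a b).

Lemma fmat_mulE a b r s :
  fmat_mul a b (r, s) = \sum_(u \in [set: T]) (a (r, u) *a b (u, s)).
Proof. by []. Qed.

Fact fmat_mulA : associative fmat_mul.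
Proof.
move=> a b c; have [X [aX bX]] := fmat_supp2 a b.
apply/fsP => -[r s].
have aX' r' s' : s' \notin X -> a (r', s') = 0.
  by move=> h; rewrite aX ?h ?orbT.
have bX' r' s' : s' \notin X -> b (r', s') = 0.
  by move=> h; rewrite bX ?h ?orbT.
have abX r' s' : s' \notin X -> fmat_mul a b (r', s') = 0.
  move=> h; rewrite [LHS](@fmat_mul_seq _ _ X)// big1// => u _.
  by rewrite bX' ?amul0r.
rewrite [LHS](@fmat_mul_seq _ _ X)// [RHS](@fmat_mul_seq _ _ X)//=.
under eq_bigr do rewrite [fmat_mul b c _](@fmat_mul_seq _ _ X)// amul_sumr.
under [RHS]eq_bigr do rewrite [fmat_mul a b _](@fmat_mul_seq _ _ X)// amul_suml.
rewrite exchange_big; apply: eq_bigr => u _; apply: eq_bigr => v _ /=.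
by rewrite amulA.
Qed.

Fact fmat_mulLl x a b c :
  fmat_mul (x *: a + b) c = x *: fmat_mul a c + fmat_mul b c.
Proof.
have [X [aX bX]] := fmat_supp2 a b.
have aX' r' s' : s' \notin X -> a (r', s') = 0.
  by move=> h; rewrite aX ?h ?orbT.
have bX' r' s' : s' \notin X -> b (r', s') = 0.
  by move=> h; rewrite bX ?h ?orbT.
apply/fsP => p; rewrite fsDE fsZE /fs_fun /= !(@fmat_mul_seq _ _ X)//.
  rewrite scaler_sumr -big_split; apply: eq_bigr => u _ /=.
  by rewrite fsDE fsZE amulDl amulZl.
by move=> r s h; rewrite fsDE fsZE aX'// bX'// scaler0 addr0.
Qed.

Fact fmat_mulLr x a b c :
  fmat_mul c (x *: a + b) = x *: fmat_mul c a + fmat_mul c b.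
Proof.
have [X cX] := fmat_supp c.
have cX' r' s' : s' \notin X -> c (r', s') = 0.
  by move=> h; rewrite cX ?h ?orbT.
apply/fsP => p; rewrite fsDE fsZE /fs_fun /= !(@fmat_mul_seq _ _ X)//.
rewrite scaler_sumr -big_split; apply: eq_bigr => u _ /=.
by rewrite fsDE fsZE amulDr amulZr.
Qed.

Lemma fmat_mul0l a : fmat_mul 0 a = 0.
Proof.
by have := fmat_mulLl (-1) 0 0 a; rewrite scaler0 add0r scaleN1r addNr.
Qed.
Lemma fmat_mul0r a : fmat_mul a 0 = 0.
Proof.
by have := fmat_mulLr (-1) 0 0 a; rewrite scaler0 add0r scaleN1r addNr.
Qed.
Fact fmat_mulDl : left_distributive fmat_mul +%R.
Proof. by move=> a b c; rewrite -[a]scale1r fmat_mulLl !scale1r. Qed.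
Fact fmat_mulDr : right_distributive fmat_mul +%R.
Proof. by move=> c a b; rewrite -[a]scale1r fmat_mulLr !scale1r. Qed.
Fact fmat_mulZl x a b : fmat_mul (x *: a) b = x *: fmat_mul a b.
Proof. by rewrite -[x *: a]addr0 fmat_mulLl fmat_mul0l addr0. Qed.
Fact fmat_mulZr x a b : fmat_mul a (x *: b) = x *: fmat_mul a b.
Proof. by rewrite -[x *: b]addr0 fmat_mulLr fmat_mul0r addr0. Qed.

HB.instance Definition _ := Lmodule_isNUAlgebra.Build k fmat
  fmat_mulA fmat_mulDl fmat_mulDr fmat_mulZl fmat_mulZr.

(* single (r, s) b is the matrix b e_{r,s} *)
Lemma fmat_mul_single r u s x y :
  (single (r, u) x : fmat) *a single (u, s) y = single (r, s) (x *a y).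
Proof.
apply/fsP => -[r' s']; rewrite [LHS](@fmat_mul_seq _ _ [fset u]%fset).
  rewrite big_seq_fset1 !singleE !xpair_eqE eqxx /= andbT.
  by case: (r' == r); case: (s' == s); rewrite ?amul0l ?amul0r.
by move=> r1 s1; rewrite inE singleE xpair_eqE andbC => /negPf ->.
Qed.

Lemma fmat_mul_in (a b : fmat) (S : set A) r s : submodule S ->
  (forall u, S (a (r, u) *a b (u, s))) -> S ((a *a b : fmat) (r, s)).
Proof.
move=> HS Sab; have [X aX] := fmat_supp a.
rewrite [X in S X](@fmat_mul_seq _ _ X) => [|r' s' h]; last first.
  by rewrite aX ?h ?orbT.
exact: submodule_sum.
Qed.
End FiniteMatrices.

Record gradedAlg (k : comPzRingType) (G : groupType) := GradedAlg {
  galg :> nuAlgType k;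
  gcomp : G -> set galg;
  gcomp_sum : direct_sum gcomp;
  gcomp_mul : forall s t, gcomp s *s gcomp t `<=` gcomp (s * t)%g
}.
Arguments gcomp {k G}.

Definition partially_strongly_graded (k : comPzRingType) (G : groupType)
    (B : gradedAlg k G) : Prop :=
  forall t : G, gcomp B t = gcomp B t *s gcomp B t^-1%g *s gcomp B t.

Section Smash.
Context {k : comPzRingType} {G : groupType} (B : gradedAlg k G).

Lemma gcomp_submodule t : submodule (gcomp B t).
Proof. exact: (gcomp_sum B).1. Qed.

Lemma mem_gcomp s t x y : gcomp B s x -> gcomp B t y -> gcomp B (s * t)%g (x *a y).
Proof. by move=> Bx By; apply: gcomp_mul; exact: mem_sprod. Qed.

Definition smash_set : set (fmat G B) :=
  [set a | forall r s, gcomp B (r^-1 * s)%g (a (r, s))].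

Lemma smash_subalgebra : subalgebra smash_set.
Proof.
split; first split=> [r s|c a b Sa Sb r s].
- exact: submodule0 (gcomp_submodule _).
- exact: (gcomp_submodule _).2.
move=> a b Sa Sb r s; apply: fmat_mul_in => [|u]; first exact: gcomp_submodule.
by have := mem_gcomp (Sa r u) (Sb u s); rewrite -mulgA mulVKg.
Qed.

(* B # G *)
Definition smash : nuAlgType k := subalg smash_subalgebra.

Definition entry (a : smash) (r s : G) : B := (sval_alg a : fmat G B) (r, s).

Lemma entryP a r s : gcomp B (r^-1 * s)%g (entry a r s).
Proof. exact: (svalP a). Qed.
Lemma entryL c (a b : smash) r s :
  entry (c *: a + b) r s = c *: entry a r s + entry b r s.
Proof. by rewrite /entry svalL. Qed.
Lemma smashP (a b : smash) : (forall r s, entry a r s = entry b r s) -> a = b.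
Proof. by move=> ab; apply: val_inj; apply/fsP => -[r s]; exact: ab. Qed.
Lemma entry_mul_in (a b : smash) (S : set B) r s : submodule S ->
  (forall u, S (entry a r u *a entry b u s)) -> S (entry (a *a b) r s).
Proof. exact: fmat_mul_in. Qed.

Definition smash_act_fun (t : G) (a : fmat G B) (p : G * G) : B :=
  a (t^-1 * p.1, t^-1 * p.2)%g.

Lemma smash_act_fin t a : fin_supp (smash_act_fun t a).
Proof.
have := finite_image (fun p => (t * p.1, t * p.2)%g) (fs_finite a).
apply: sub_finite_set => -[r s] /= ars; exists (t^-1 * r, t^-1 * s)%g => //=.
by rewrite !mulVKg.
Qed.

Lemma smash_act_subproof t (a : smash) :
  smash_set (mkfs (smash_act_fin t (sval_alg a))).
Proof.
move=> r s; have := entryP a (t^-1 * r)%g (t^-1 * s)%g.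
by rewrite invgM invgK -mulgA mulVKg.
Qed.

Definition smash_act (t : G) (a : smash) : smash := 
  mkalg smash_subalgebra (smash_act_subproof t a).

Lemma smash_actE t a r s :
  entry (smash_act t a) r s = entry a (t^-1 * r)%g (t^-1 * s)%g.
Proof. by []. Qed.

End Smash.

(* f restricts to an algebra isomorphism from U to V; its values outside U do   *)
(* not matter.                                                                *)
Definition alg_iso_on (k : comPzRingType) (A : nuAlgType k) (U V : set A)
    (f : A -> A) : Prop :=
  [/\ set_bij U V f,
      forall c x y, U x -> U y -> f (c *: x + y) = c *: f x + f y &
      forall x y, U x -> U y -> f (x *a y) = f x *a f y].

(* Product partial actions; [pact t] is only meaningful on [pdom t^-1]. *)
Record partialAction (k : comPzRingType) (G : groupType) (A : nuAlgType k) :=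
  PartialAction {
  pdom : G -> set A;
  pact : G -> A -> A;
  pdom_ideal : forall t, ideal (pdom t);
  pact_iso : forall t, alg_iso_on (pdom t^-1%g) (pdom t) (pact t);
  pdom1 : pdom 1%g = [set: A];
  pact1 : forall x, pact 1%g x = x;
  pdom_idem : forall t, idem_set (pdom t);
  pdom_comm : forall s t, pdom s *s pdom t = pdom t *s pdom s;
  pact_dom : forall s t,
    pact s @` (pdom s^-1%g *s pdom t) = pdom s *s pdom (s * t)%g;
  pact_comp : forall s t x, (pdom t^-1%g *s pdom (s * t)^-1%g) x ->
    pact s (pact t x) = pact (s * t)%g x
}.

Section SkewGroupAlgebra.
Context {k : comPzRingType} {G : groupType} {A : nuAlgType k}.
Context (al : partialAction G A).
Local Notation D := (pdom al).
Local Notation act := (pact al).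

Lemma pdom_submodule t : submodule (D t).
Proof. exact: (pdom_ideal al t).1. Qed.
Lemma pdom_mull t x y : D t x -> D t (x *a y).
Proof. by move=> Dx; exact: ((pdom_ideal al t).2 _ _ Dx).1. Qed.
Lemma pdom_mulr t x y : D t x -> D t (y *a x).
Proof. by move=> Dx; exact: ((pdom_ideal al t).2 _ _ Dx).2. Qed.
Lemma pact_in t x : D t^-1%g x -> D t (act t x).
Proof. by have [[fS _ _] _ _] := pact_iso al t; exact: fS. Qed.
Lemma pactV_in t x : D t x -> D t^-1%g (act t^-1%g x).
Proof. by move=> Dx; apply: pact_in; rewrite invgK. Qed.
Lemma pactL t c x y : D t^-1%g x -> D t^-1%g y ->
  act t (c *: x + y) = c *: act t x + act t y.
Proof. by have [_ + _] := pact_iso al t; exact. Qed.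
Lemma pactM t x y : D t^-1%g x -> D t^-1%g y ->
  act t (x *a y) = act t x *a act t y.
Proof. by have [_ _] := pact_iso al t; exact. Qed.
Lemma pact0 t : act t 0 = 0.
Proof.
have D0 := submodule0 (pdom_submodule t^-1%g).
by have := pactL (-1) D0 D0; rewrite scaler0 add0r scaleN1r addNr.
Qed.
Lemma pdom_meetl s t : D s *s D t `<=` D s.
Proof. by apply: sprod_sub (pdom_submodule _) _ => x y Dx _; exact: pdom_mull. Qed.
Lemma pdom_meetr s t : D s *s D t `<=` D t.
Proof. by apply: sprod_sub (pdom_submodule _) _ => x y _; exact: pdom_mulr. Qed.

Lemma pactK t x : D t^-1%g x -> act t^-1%g (act t x) = x.
Proof.
move=> Dx; rewrite pact_comp mulVg ?pact1// invg1 pdom1.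
by move: Dx; rewrite -{1}(pdom_idem al t^-1%g); apply: sprodS.
Qed.
Lemma pactVK t x : D t x -> act t (act t^-1%g x) = x.
Proof. by move=> Dx; have := @pactK t^-1%g x; rewrite invgK; apply. Qed.

Lemma skew_submodule : submodule [set f : fs G A | forall t, D t (f t)].
Proof.
split=> [t|c f g Df Dg t]; first exact: submodule0 (pdom_submodule t).
by rewrite fsDE fsZE; exact: (pdom_submodule t).2.
Qed.

Definition skew := subm skew_submodule.
HB.instance Definition _ := GRing.Lmodule.on skew.

(* On [D r] the inverse of [act r] is [act r^-1], see [pactK], [pactVK]. *)
Definition skew_term (r s : G) (a b : A) : fs G A :=
  single (r * s)%g (act r (act r^-1%g a *a b)).

(* The bilinear extension of (a delta_r)(b delta_s), cf. [skew_mul_delta]. *)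
Definition skew_mul_fs (f g : fs G A) : fs G A :=
  fs_sum (fun r a => fs_sum (fun s b => skew_term r s a b) g) f.

Local Notation Sk := [set f : fs G A | forall t, D t (f t)].

Lemma skew_term_in r s a b : D r a -> D s b -> Sk (skew_term r s a b).
Proof.
move=> Da Db t /=; rewrite /skew_term singleE.
case: eqP => [->|_]; last exact: submodule0 (pdom_submodule t).
have := pact_dom al r s => E; apply: (@pdom_meetr r (r * s)%g).
rewrite -E; exists (act r^-1%g a *a b) => //.
by apply: mem_sprod => //; exact: pactV_in.
Qed.

Lemma skew_term0r r s a : skew_term r s a 0 = 0.
Proof. by rewrite /skew_term amul0r pact0 linear0. Qed.
Lemma skew_term0l r s b : skew_term r s 0 b = 0.
Proof. by rewrite /skew_term pact0 amul0l pact0 linear0. Qed.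

Lemma skew_termLr r s a c b b' : D r a ->
  skew_term r s a (c *: b + b') = c *: skew_term r s a b + skew_term r s a b'.
Proof.
move=> Da; rewrite /skew_term amulDr amulZr pactL ?linearP//;
by apply: pdom_mull; exact: pactV_in.
Qed.

Lemma skew_termLl r s c a a' b : D r a -> D r a' ->
  skew_term r s (c *: a + a') b = c *: skew_term r s a b + skew_term r s a' b.
Proof.
move=> Da Da'; rewrite /skew_term pactL ?invgK// amulDl amulZl pactL ?linearP//;
by apply: pdom_mull; exact: pactV_in.
Qed.

Lemma skew_mulLr (c : k) (f g h : fs G A) : Sk f ->
  skew_mul_fs f (c *: g + h) = c *: skew_mul_fs f g + skew_mul_fs f h.
Proof.
move=> Sf; have [X fX] := fs_supp f.
rewrite /skew_mul_fs !(fs_sum_seq _ fX); last first.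
- by move=> t; apply: fsbig1 => s _; rewrite skew_term0l.
- by move=> t; apply: fsbig1 => s _; rewrite skew_term0l.
- by move=> t; apply: fsbig1 => s _; rewrite skew_term0l.
rewrite scaler_sumr -big_split; apply: eq_bigr => r _ /=.
rewrite fs_sum_linear// => t; first exact: skew_term0r.
exact: skew_termLr (Sf r).
Qed.

Lemma skew_mulLl (c : k) (f g h : fs G A) : Sk f -> Sk g ->
  skew_mul_fs (c *: f + g) h = c *: skew_mul_fs f h + skew_mul_fs g h.
Proof.
move=> Sf Sg; have [X hX] := fs_supp h.
rewrite /skew_mul_fs fs_sum_linear// => t.
  by apply: fsbig1 => s _; rewrite skew_term0l.
rewrite !(fs_sum_seq _ hX); try by move=> s; rewrite skew_term0r.
rewrite scaler_sumr -big_split; apply: eq_bigr => r _ /=.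
by rewrite skew_termLl; [|exact: Sf|exact: Sg].
Qed.

Lemma skew_mul0l g : skew_mul_fs 0 g = 0.
Proof.
by apply: fs_sum0 => t; apply: fsbig1 => s _; rewrite skew_term0l.
Qed.
Lemma skew_mul0r f : Sk f -> skew_mul_fs f 0 = 0.
Proof.
move=> Sf; have := skew_mulLr (-1) 0 0 Sf.
by rewrite scaler0 add0r scaleN1r addNr.
Qed.

Lemma skew_mul_single r s a b :
  skew_mul_fs (single r a) (single s b) = skew_term r s a b.
Proof.
rewrite /skew_mul_fs fs_sum_single => [|t].
  by rewrite fs_sum_single// => t; exact: skew_term0r.
by apply: fsbig1 => t' _; rewrite skew_term0l.
Qed.

Lemma skew_mul_in f g : Sk f -> Sk g -> Sk (skew_mul_fs f g).
Proof.
move=> Sf Sg; apply: fs_sum_in => [t||r].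
- by apply: fsbig1 => s _; rewrite skew_term0l.
- exact: skew_submodule.
apply: fs_sum_in => [t||s]; first exact: skew_term0r.
  exact: skew_submodule.
by apply: skew_term_in; [exact: Sf|exact: Sg].
Qed.

(* The key identity behind associativity; it uses the idempotence of [D s]. *)
Lemma skew_key s a b c : D s b ->
  act s (act s^-1%g (a *a b) *a c) = a *a act s (act s^-1%g b *a c).
Proof.
suff : D s `<=` [set b | D s b /\
    act s (act s^-1%g (a *a b) *a c) = a *a act s (act s^-1%g b *a c)].
  by move=> H /H[].
rewrite -[X in X `<=` _](pdom_idem al s); apply: sprod_sub => [|x y Dx Dy].
  split=> [|d x y [Dx Ex] [Dy Ey]].
    split; first exact: submodule0 (pdom_submodule s).
    by rewrite !(amul0r, pact0, amul0l).
  split; first exact: (pdom_submodule s).2.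
  rewrite amulDr amulZr !pactL ?invgK//; try exact: pdom_mulr.
  rewrite !amulDl !amulZl !pactL; try by apply: pdom_mull; apply: pactV_in;
    rewrite ?invgK//; exact: pdom_mulr.
  by rewrite Ex Ey amulDr amulZr.
have DV z : D s z -> D s^-1%g^-1%g z by rewrite invgK.
split; first exact: pdom_mull.
have Dax := pdom_mulr a Dx.
have DVx := pactV_in Dx; have DVy := pactV_in Dy; have DVax := pactV_in Dax.
rewrite amulA (pactM (DV _ Dax) (DV _ Dy)) (pactM (DV _ Dx) (DV _ Dy)).
have DVyc := pdom_mull c DVy.
rewrite -!amulA (pactM DVax DVyc) (pactM DVx DVyc).
by rewrite (pactVK Dax) (pactVK Dx) amulA.
Qed.

Lemma skew_mulA_single r s t a b c : D r a -> D s b -> D t c ->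
  skew_mul_fs (single r a) (skew_mul_fs (single s b) (single t c)) =
  skew_mul_fs (skew_mul_fs (single r a) (single s b)) (single t c).
Proof.
move=> Da Db Dc; rewrite !skew_mul_single /skew_term.
rewrite mulgA; congr single.
set a' := act r^-1%g a; have Da' : D r^-1%g a' by exact: pactV_in.
have Dz : (D r^-1%g *s D s) (a' *a b) by exact: mem_sprod.
have Ez : act (r * s)%g^-1%g (act r (a' *a b)) = act s^-1%g (a' *a b).
  rewrite invgM -(@pact_comp _ _ _ al s^-1%g r^-1%g).
    by rewrite pactK//; exact: pdom_mull.
  rewrite invgK -invgM invgK -(pact_dom al).
  by exists (a' *a b).
have Dw : (D s^-1%g *s D (r * s)^-1%g) (act s^-1%g (a' *a b)).
  rewrite invgM -(pact_dom al); exists (a' *a b) => //.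
  by rewrite invgK pdom_comm.
rewrite Ez -(@pact_comp _ _ _ al r s); last first.
  by have [_ /(_ _ c Dw)[]] := ideal_sprod (pdom_ideal al s^-1%g)
    (pdom_ideal al (r * s)^-1%g).
by rewrite skew_key.
Qed.

Lemma skew_mul_fsA f g h : Sk f -> Sk g -> Sk h ->
  skew_mul_fs f (skew_mul_fs g h) = skew_mul_fs (skew_mul_fs f g) h.
Proof.
have SI := skew_mul_in; have Ss t v : D t v -> Sk (single t v).
  move=> Dv t' /=; rewrite singleE; case: eqP => [->//|_].
  exact: submodule0 (pdom_submodule t').
have DS := pdom_submodule.
have addl u v w : Sk u -> Sk v ->
    skew_mul_fs (u + v) w = skew_mul_fs u w + skew_mul_fs v w.
  by move=> Su Sv; rewrite -[u]scale1r skew_mulLl// !scale1r.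
have addr u v w : Sk u ->
    skew_mul_fs u (v + w) = skew_mul_fs u v + skew_mul_fs u w.
  by move=> Su; rewrite -[v]scale1r skew_mulLr// !scale1r.
move=> Sf Sg Sh; move: f Sf; apply: (fs_ind DS) => [|f f' Sf Sf' IH IH'|r a Da].
- by rewrite !skew_mul0l.
- by rewrite !addl ?IH ?IH'//; exact: SI.
have Sa := Ss _ _ Da.
move: g Sg; apply: (fs_ind DS) => [|f f' Sf Sf' IH IH'|s b Db].
- by rewrite !(skew_mul0l, skew_mul0r).
- by rewrite addr// !addl ?addr ?IH ?IH'//; exact: SI.
have Sb := Ss _ _ Db.
move: h Sh; apply: (fs_ind DS) => [|f f' Sf Sf' IH IH'|t c Dc].
- by rewrite !skew_mul0r//; exact: SI.
- by rewrite !addr// ?IH ?IH'//; exact: SI.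
exact: skew_mulA_single.
Qed.

Definition skew_mul (f g : skew) : skew :=
  mksub skew_submodule (skew_mul_in (submP f) (submP g)).

Fact skew_mulA : associative skew_mul.
Proof. by move=> f g h; apply: val_inj; apply: skew_mul_fsA; exact: submP. Qed.
Fact skew_mulDl : left_distributive skew_mul +%R.
Proof.
move=> f g h; apply: val_inj => /=.
rewrite -[subm_val f]scale1r skew_mulLl ?scale1r//; exact: submP.
Qed.
Fact skew_mulDr : right_distributive skew_mul +%R.
Proof.
move=> f g h; apply: val_inj => /=.
rewrite -[subm_val g]scale1r skew_mulLr ?scale1r//; exact: submP.
Qed.
Fact skew_mulZl (c : k) (f g : skew) : skew_mul (c *: f) g = c *: skew_mul f g.
Proof.
apply: val_inj => /=; rewrite -[c *: _]addr0 skew_mulLl ?skew_mul0l ?addr0//.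
  exact: submP.
exact: submodule0 skew_submodule.
Qed.
Fact skew_mulZr (c : k) (f g : skew) : skew_mul f (c *: g) = c *: skew_mul f g.
Proof.
apply: val_inj => /=; rewrite -[c *: subm_val g]addr0 skew_mulLr.
  by rewrite skew_mul0r ?addr0//; exact: submP.
exact: submP.
Qed.
HB.instance Definition _ := Lmodule_isNUAlgebra.Build k skew
  skew_mulA skew_mulDl skew_mulDr skew_mulZl skew_mulZr.

Definition skew_fs (f : skew) : fs G A := val f.

(* D_t delta_t *)
Definition skew_comp (t : G) : set skew :=
  [set f | exists2 a, D t a & skew_fs f = single t a].

Lemma single_skew t a : D t a -> Sk (single t a).
Proof.
move=> Da t' /=; rewrite singleE; case: eqP => [->//|_].
exact: submodule0 (pdom_submodule t').
Qed.

Definition delta t a (Da : D t a) : skew :=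
  mksub skew_submodule (single_skew Da).

Lemma skew_mul_delta r s a b (Da : D r a) (Db : D s b) :
  skew_fs (delta Da *a delta Db) =
  single (r * s)%g (act r (act r^-1%g a *a b)).
Proof. exact: skew_mul_single. Qed.

Lemma skew_fs_sum I (r : seq I) (F : I -> skew) :
  skew_fs (\sum_(i <- r) F i) = \sum_(i <- r) skew_fs (F i).
Proof. by elim/big_rec2: _ => //= i x y _ <-. Qed.

Lemma skew_comp_sum : direct_sum skew_comp.
Proof.
split=> [t|f].
  split=> [|c f g [a Da fE] [b Db gE]].
    by exists 0; [exact: submodule0 (pdom_submodule t)|rewrite linear0].
  exists (c *: a + b); first exact: (pdom_submodule t).2.
  by rewrite linearP /= -fE -gE.
have [X fX] := fs_supp (skew_fs f).
pose F t : skew := delta (submP f t).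
have F0 t : t \notin X -> F t = 0.
  by by move=> /fX ft; apply: val_inj; rewrite /= -[subm_val f]/(skew_fs f) ft linear0.
have Ffin : fin_supp F.
  apply: (sub_finite_set _ (finite_fset X)) => t /= Ft.
  by apply: contrapT => /negP/F0.
have FE t : skew_fs (F t) = single t (skew_fs f t) by [].
exists (mkfs Ffin); split.
  split=> [t|]; first by exists (skew_fs f t) => //; exact: (submP f t).
  apply: val_inj; rewrite [in RHS](fsbigTE X)//.
  rewrite [RHS](skew_fs_sum (enum_fset X) F); apply/fsP => t; rewrite fs_sumE.
  have [tX|tX] := boolP (t \in X); last first.
    rewrite [LHS]fX// big_seq big1// => t' t'X; rewrite FE singleE.
    by case: eqP t'X tX => // <- ->.
  rewrite (bigD1_seq t) ?fset_uniq//= FE single_at big1 ?addr0// => t' t't.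
  by rewrite FE singleE eq_sym (negPf t't).
move=> H [HD fE]; apply/fsP => t; apply: val_inj.
have [a Da HE] := HD t; rewrite [RHS]HE [LHS]FE; congr single.
have [Y HY] := fs_supp H.
rewrite fE (fsbigTE Y)// skew_fs_sum fs_sumE.
have Ht t' : t' != t -> skew_fs (H t') t = 0.
  by move=> t't; have [a' _ ->] := HD t'; rewrite singleE eq_sym (negPf t't).
have [tY|tY] := boolP (t \in Y).
  rewrite (bigD1_seq t) ?fset_uniq//= big1 ?addr0//.
  by rewrite HE single_at.
rewrite big_seq big1 => [|t' t'Y]; last first.
  by apply: Ht; apply: contraNneq tY => <-.
by have := HE; rewrite HY// => /fsP/(_ t); rewrite single_at => <-.
Qed.

Lemma skew_comp_mul s t :
  skew_comp s *s skew_comp t `<=` skew_comp (s * t)%g.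
Proof.
apply: sprod_sub => [|f g [a Da fE] [b Db gE]]; first exact: skew_comp_sum.1.
exists (act s (act s^-1%g a *a b)).
  have := skew_term_in Da Db (s * t)%g.
  by rewrite /skew_term single_at.
have := skew_mul_single s t a b.
by rewrite -fE -gE.
Qed.

Definition skew_graded : gradedAlg k G := GradedAlg skew_comp_sum skew_comp_mul.

End SkewGroupAlgebra.

Record algAction (k : comPzRingType) (G : groupType) (A : nuAlgType k) :=
  AlgAction {
  gact :> G -> A -> A;
  gact_hom : forall t, alg_hom (gact t);
  gact1 : forall x, gact 1%g x = x;
  gactM : forall s t x, gact (s * t)%g x = gact s (gact t x)
}.

Section ActionTheory.
Context {k : comPzRingType} {G : groupType} {A : nuAlgType k}.
Context (be : algAction G A).

Lemma gactK t : cancel (be t) (be t^-1%g).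
Proof. by move=> x; rewrite -gactM mulVg gact1. Qed.
Lemma gactVK t : cancel (be t^-1%g) (be t).
Proof. by move=> x; rewrite -gactM mulgV gact1. Qed.

Lemma image_gactM s t (S : set A) : be s @` (be t @` S) = be (s * t)%g @` S.
Proof.
by rewrite image_comp; congr image; apply/funext => x /=; rewrite gactM.
Qed.
Lemma image_gact1 (S : set A) : be 1%g @` S = S.
Proof.
by rewrite -[RHS]image_id; congr image; apply/funext => x; exact: gact1.
Qed.
Lemma image_gactT t : be t @` [set: A] = [set: A].
Proof.
by apply/seteqP; split=> // x _; exists (be t^-1%g x) => //; exact: gactVK.
Qed.

Lemma image_gact_ideal t (S : set A) : ideal S -> ideal (be t @` S).
Proof.
move=> [HS SM]; have [bL bM] := gact_hom be t.
split=> [|_ y [x Sx <-]]; first exact: image_submodule.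
have [S1 S2] := SM x (be t^-1%g y) Sx.
by split; [exists (x *a be t^-1%g y)|exists (be t^-1%g y *a x)];
  rewrite // bM gactVK.
Qed.

Lemma gact_alg_iso (S S' : set A) t : be t @` S = S' -> alg_iso_on S S' (be t).
Proof.
move=> <-; have [bL bM] := gact_hom be t; split.
- split=> [x Sx|x y _ _|//]; first by exists x.
  exact: (can_inj (gactK t)).
- by move=> c x y _ _; exact: bL.
- by move=> x y _ _; exact: bM.
Qed.

Section Global.
Hypothesis A_idem : idem_set [set: A].

Fact global_ideal (t : G) : ideal [set: A].
Proof. by []. Qed.
Fact global_iso t : alg_iso_on [set: A] [set: A] (be t).
Proof. exact/gact_alg_iso/image_gactT. Qed.
Fact global_dom (s t : G) :
  be s @` ([set: A] *s [set: A]) = [set: A] *s [set: A].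
Proof. by rewrite A_idem image_gactT. Qed.

(* A global action on an idempotent algebra, all domains being A. *)
Definition global_pact : partialAction G A :=
  @PartialAction k G A (fun=> [set: A]) be global_ideal global_iso erefl
    (gact1 be) (fun=> A_idem) (fun _ _ => erefl) global_dom
    (fun s t x _ => esym (gactM be s t x)).
End Global.

Section Restriction.
Context {I : set A} (HI : ideal I) (I_idem : idem_set I).
Hypothesis I_comm : forall t, I *s (be t @` I) = (be t @` I) *s I.
Local Notation IA := (subalg (ideal_subalgebra HI)).
Let J t := be t @` I.

Definition restr_dom (t : G) : set IA :=
  [set x | (I *s (be t @` I)) (sval_alg x)].

(* [be t x] when it lies in I, in particular for x in the domain at t^-1. *)
Definition restr_act (t : G) (x : IA) : IA := insubd (0 : IA) (be t (sval_alg x)).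

Lemma restr_actE t x : I (be t (sval_alg x)) ->
  sval_alg (restr_act t x) = be t (sval_alg x).
Proof.
by move=> Ix; rewrite /sval_alg val_insubd ifT// inE.
Qed.

Let J_ideal t : ideal (J t). Proof. exact: image_gact_ideal. Qed.
Let J_act s t : be s @` J t = J (s * t)%g. Proof. exact: image_gactM. Qed.
Let J_idem t : J t *s J t = J t.
Proof. by rewrite -(image_sprod _ _ (gact_hom be t)) I_idem. Qed.
Let J_comm s t : J s *s J t = J t *s J s.
Proof.
have -> : J t = be s @` J (s^-1 * t)%g by rewrite J_act mulVKg.
by rewrite -!(image_sprod _ _ (gact_hom be s)) I_comm.
Qed.
Let J1 : J 1%g = I. Proof. exact: image_gact1. Qed.
Let IJ_l t : I *s J t `<=` I.
Proof. by apply: sprod_sub HI.1 _ => x y Ix _; exact: (HI.2 _ _ Ix).1. Qed.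
Let IJ_r t : I *s J t `<=` J t.
Proof.
by apply: sprod_sub (J_ideal t).1 _ => x y _ Jy; exact: ((J_ideal t).2 _ _ Jy).2.
Qed.
Let IJ_act t : be t @` (I *s J t^-1%g) = I *s J t.
Proof.
by rewrite (image_sprod _ _ (gact_hom be t)) J_act mulgV J1 -I_comm.
Qed.

Let sval_hom : alg_hom (@sval_alg k A I (ideal_subalgebra HI)).
Proof. by split. Qed.

Let sval_image_inj (U V : set IA) :
  (@sval_alg _ _ _ _ @` U) = (@sval_alg _ _ _ _ @` V) -> U = V.
Proof.
move=> UV; apply/seteqP; split=> x Hx.
  have : (@sval_alg _ _ _ _ @` V) (sval_alg x) by rewrite -UV; exists x.
  by case=> y Vy /sval_inj <-.
have : (@sval_alg _ _ _ _ @` U) (sval_alg x) by rewrite UV; exists x.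
by case=> y Uy /sval_inj <-.
Qed.

Let sval_prod (U V : set IA) : (@sval_alg _ _ _ _ @` (U *s V)) =
  (@sval_alg _ _ _ _ @` U) *s (@sval_alg _ _ _ _ @` V).
Proof. exact: image_sprod sval_hom. Qed.

Let sval_dom t : @sval_alg _ _ _ _ @` (restr_dom t) = I *s J t.
Proof.
apply/seteqP; split=> [_ [x Wx <-]//|x Wx].
by exists (mkalg (ideal_subalgebra HI) (IJ_l Wx)).
Qed.

Fact restr_dom_ideal t : ideal (restr_dom t).
Proof.
have [WS WM] := ideal_sprod HI (J_ideal t).
split; first exact: (preim_submodule sval_hom.1 WS).
by move=> x y Wx; have [] := WM _ (sval_alg y) Wx.
Qed.

Let restr_act_dom t x : restr_dom t^-1%g x -> (I *s J t) (be t (sval_alg x)).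
Proof. by move=> Wx; rewrite -IJ_act; exists (sval_alg x). Qed.
Let restr_actE' t x : restr_dom t^-1%g x ->
  sval_alg (restr_act t x) = be t (sval_alg x).
Proof. by move=> Wx; apply/restr_actE/IJ_l; exact: restr_act_dom. Qed.

Let sval_act t (U : set IA) : U `<=` restr_dom t^-1%g ->
  @sval_alg _ _ _ _ @` (restr_act t @` U) = be t @` (@sval_alg _ _ _ _ @` U).
Proof.
move=> UW; rewrite !image_comp; apply: eq_imagel => x Ux /=.
by rewrite restr_actE'//; exact: UW.
Qed.

Fact restr_iso t : alg_iso_on (restr_dom t^-1%g) (restr_dom t) (restr_act t).
Proof.
have [bL bM] := gact_hom be t; have [WS WM] := restr_dom_ideal t^-1%g.
split=> [|c x y Wx Wy|x y Wx Wy].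
- have WE : restr_act t @` restr_dom t^-1%g = restr_dom t.
    by apply: sval_image_inj; rewrite sval_act// !sval_dom IJ_act.
  split=> [x Wx|x y|]; first by rewrite -WE; exists x.
    rewrite !inE => Wx Wy E; apply: sval_inj; apply: (can_inj (gactK t)).
    by rewrite -!restr_actE'// E.
  by rewrite -[X in set_surj _ X]WE.
- apply: sval_inj; rewrite svalL !restr_actE'//; first exact: bL.
  exact: WS.2.
- apply: sval_inj; rewrite svalM !restr_actE'//; first exact: bM.
  exact: (WM _ _ Wx).1.
Qed.

Fact restr_dom1 : restr_dom 1%g = [set: IA].
Proof.
apply/seteqP; split=> // x _.
by rewrite /restr_dom /= image_gact1 I_idem; exact: svalP.
Qed.
Fact restr_act1 x : restr_act 1%g x = x.
Proof.
by apply: sval_inj; rewrite restr_actE ?gact1//; exact: svalP.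
Qed.

Let I_J t : I *s J t = J t *s I. Proof. exact: I_comm. Qed.

Let WW s t : (I *s J s) *s (I *s J t) = I *s (J s *s J t).
Proof.
by rewrite sprodA -(sprodA I (J s)) -I_J sprodA I_idem -sprodA.
Qed.

Fact restr_dom_comm s t :
  restr_dom s *s restr_dom t = restr_dom t *s restr_dom s.
Proof. by apply: sval_image_inj; rewrite !sval_prod !sval_dom !WW J_comm. Qed.

Fact restr_dom_idem t : idem_set (restr_dom t).
Proof. by apply: sval_image_inj; rewrite sval_prod !sval_dom WW J_idem. Qed.

Fact restr_act_meet s t : restr_act s @` (restr_dom s^-1%g *s restr_dom t) =
  restr_dom s *s restr_dom (s * t)%g.
Proof.
apply: sval_image_inj; rewrite sval_act; last first.
  apply: sprod_sub (restr_dom_ideal _).1 _ => x y Wx _.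
  exact: ((restr_dom_ideal _).2 _ _ Wx).1.
rewrite !sval_prod !sval_dom !WW !(image_sprod _ _ (gact_hom be s)) !J_act.
by rewrite mulgV J1 -/(J s) sprodA -I_J -sprodA sprodA I_J -sprodA.
Qed.

Fact restr_act_comp s t x :
  (restr_dom t^-1%g *s restr_dom (s * t)^-1%g) x ->
  restr_act s (restr_act t x) = restr_act (s * t)%g x.
Proof.
move=> Wx; have W1 : restr_dom t^-1%g x.
  move: x Wx; apply: sprod_sub (restr_dom_ideal _).1 _ => x y Wx _.
  exact: ((restr_dom_ideal _).2 _ _ Wx).1.
have W2 : restr_dom (s * t)^-1%g x.
  move: x Wx {W1}; apply: sprod_sub (restr_dom_ideal _).1 _ => x y _ Wx.
  exact: ((restr_dom_ideal _).2 _ _ Wx).2.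
have E := restr_actE' W2.
apply: sval_inj; rewrite E gactM -(restr_actE' W1) restr_actE//.
by rewrite (restr_actE' W1) -gactM -E; exact: svalP.
Qed.

Definition restr_pact : partialAction G IA :=
  PartialAction restr_dom_ideal restr_iso restr_dom1 restr_act1
    restr_dom_idem restr_dom_comm restr_act_meet restr_act_comp.

End Restriction.
End ActionTheory.

Section PartialSmash.
Context {k : comPzRingType} {G : groupType} (B : gradedAlg k G).
Local Notation Bc t := (gcomp B t%g).
Implicit Types a b : smash B.

Fact smash_act_hom t : alg_hom (@smash_act k G B t).
Proof.
split=> [c a b|a b]; apply: smashP => r s.
  by rewrite entryL !smash_actE entryL.
rewrite smash_actE /entry !svalM.
rewrite [LHS](reindex_fsbigT (fun u => (t^-1 * u)%g))//.
by exists (fun u => t * u)%g => u; rewrite ?mulKg ?mulVKg.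
Qed.
Fact smash_act1 a : smash_act 1%g a = a.
Proof. by apply: smashP => r s; rewrite smash_actE invg1 !mul1g. Qed.
Fact smash_actM s t a : smash_act (s * t)%g a = smash_act s (smash_act t a).
Proof. by apply: smashP => r u; rewrite !smash_actE invgM !mulgA. Qed.

(* beta^B *)
Definition smash_action : algAction G (smash B) :=
  AlgAction smash_act_hom smash_act1 smash_actM.

(* b e_{r,s}, for b in B_{r^-1 s} *)
Lemma smash_single_subproof r s (x : B) :
  Bc (r^-1 * s) x -> smash_set (single (r, s) x : fmat G B).
Proof.
move=> Bx r' s'; rewrite singleE xpair_eqE.
by case: eqP => [->|_]; [case: eqP => [->|_]|]; rewrite //=;
  apply: submodule0 (gcomp_submodule _ _).
Qed.
Definition smash_single r s (x : B) (Bx : Bc (r^-1 * s) x) : smash B :=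
  mkalg (smash_subalgebra B) (smash_single_subproof Bx).

Lemma smash_act_single t r s x (Bx : Bc (r^-1 * s) x)
    (Bx' : Bc ((t * r)^-1 * (t * s)) x) :
  smash_act t (smash_single Bx) = smash_single Bx'.
Proof.
apply: smashP => r' s'; rewrite smash_actE /entry /= !singleE !xpair_eqE.
by rewrite -!(inj_eq (mulgI t) (t^-1 * _)%g) !mulVKg.
Qed.

(* I^B *)
Definition psmash : set (smash B) :=
  [set a | forall r s, (Bc r^-1 *s Bc s) (entry a r s)].

Let BM s t x y : Bc s x -> Bc t y -> Bc (s * t) (x *a y).
Proof. exact: mem_gcomp. Qed.
Let BS t : submodule (Bc t). Proof. exact: gcomp_submodule. Qed.
Let pS (U V : set B) : submodule (U *s V). Proof. exact: submodule_sprod. Qed.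

Fact psmash_ideal : ideal psmash.
Proof.
split.
  split=> [r s|c a b Ia Ib r s]; first exact: submodule0.
  by rewrite entryL; apply: (pS _ _).2.
move=> a b Ia; split=> r s; apply: entry_mul_in => // u.
  have := mem_sprod (Ia r u) (entryP b u s); rewrite -sprodA.
  apply: sprodS => //; apply: sprod_sub => // x y Bx By.
  by have := BM Bx By; rewrite mulVKg.
have := mem_sprod (entryP b r u) (Ia u s); rewrite sprodA.
apply: sprodS => //; apply: sprod_sub => // x y Bx By.
by have := BM Bx By; rewrite mulgK.
Qed.

(* The partial smash product I^B as an algebra. *)
Definition psmash_alg : nuAlgType k := subalg (ideal_subalgebra psmash_ideal).

Lemma smash_sum_in (N : set (smash B)) (S : G -> G -> set B) a :
  submodule N -> (forall r s, submodule (S r s)) ->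
  (forall r s x (Bx : Bc (r^-1 * s) x), S r s x -> N (smash_single Bx)) ->
  (forall r s, S r s (entry a r s)) -> N a.
Proof.
move=> HN HS NS Sa.
have [X _ [_ aE]] := fs_decomp (sval_alg a : fmat G B).
have -> : a = \sum_(p <- X) smash_single (entryP a p.1 p.2).
  apply: smashP => r s; rewrite {1}/entry {1}aE.
  rewrite /entry; congr (fs_fun _ _).
  elim/big_rec2: _ => [//|[r' s'] x y _ ->].
  by [].
by apply: submodule_sum => // p; exact: NS.
Qed.

(* Reduction of a membership for products, single entry by single entry. *)
Lemma single_sprod (N : set (smash B)) (U V : set B) r t s :
  submodule N -> submodule U -> submodule V ->
  (forall x, U x -> Bc (r^-1 * t) x) -> (forall y, V y -> Bc (t^-1 * s) y) ->
  (forall x y (Bx : Bc (r^-1 * t) x) (By : Bc (t^-1 * s) y), U x -> V y ->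
     N (smash_single Bx *a smash_single By)) ->
  forall z (Bz : Bc (r^-1 * s) z), (U *s V) z -> N (smash_single Bz).
Proof.
move=> HN HU HV UB VB NUV z Bz UVz.
have zE (x y : B) (e : x = y) (Bx : Bc (r^-1 * s) x) (By : Bc (r^-1 * s) y) :
    smash_single Bx = smash_single By.
  by apply: val_inj; rewrite /= e.
suff [Bz' Nz] : exists Bz' : Bc (r^-1 * s) z, N (smash_single Bz').
  by rewrite (zE _ _ erefl Bz Bz').
move: z UVz {Bz}; apply: sprod_sub => [|x y Ux Vy].
  split=> [|c x y [Bx Nx] [By Ny]].
    exists (submodule0 (BS _)).
    rewrite [X in N X](_ : _ = 0); first exact: submodule0.
    by apply: val_inj => /=; rewrite linear0.
  exists ((BS _).2 _ _ _ Bx By).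
  rewrite [X in N X](_ : _ = c *: smash_single Bx + smash_single By).
    exact: HN.2.
  by apply: val_inj => /=; rewrite linearP.
have Bx := UB _ Ux; have By := VB _ Vy.
have Bxy : Bc (r^-1 * s) (x *a y).
  by have := BM Bx By; rewrite -mulgA mulVKg.
exists Bxy; rewrite [X in N X](_ : _ = smash_single Bx *a smash_single By).
  exact: NUV.
by apply: val_inj; rewrite /= -[LHS](fmat_mul_single r t s x y).
Qed.

Lemma entry_single r s x (Bx : Bc (r^-1 * s) x) (S : G -> G -> set B) :
  (forall r s, submodule (S r s)) -> S r s x ->
  forall r' s', S r' s' (entry (smash_single Bx) r' s').
Proof.
move=> HS Sx r' s'; rewrite /entry /= singleE xpair_eqE.
by case: eqP => [->|_]; [case: eqP => [->|_]|]; rewrite //=; exact: submodule0.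
Qed.

Hypothesis hB : partially_strongly_graded B.

Let B3 t : Bc t `<=` Bc 1 *s Bc t.
Proof.
rewrite [X in X `<=` _]hB; apply: sprodS => //.
by apply: sprod_sub => // x y Bx By; rewrite -(mulgV t); exact: BM.
Qed.
Let B3r t : Bc t `<=` Bc t *s Bc 1.
Proof.
rewrite [X in X `<=` _]hB -sprodA; apply: sprodS => //.
by apply: sprod_sub => // x y Bx By; rewrite -(mulVg t); exact: BM.
Qed.
Let BBl s t : Bc s *s Bc t `<=` Bc s *s (Bc s^-1 *s Bc (s * t)).
Proof.
rewrite [X in X *s _ `<=` _]hB -!sprodA; apply: sprodS => //.
by apply: sprodS => //; exact: gcomp_mul.
Qed.
Let BBr s t : Bc s *s Bc t `<=` Bc (s * t) *s Bc t^-1 *s Bc t.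
Proof.
rewrite [X in _ *s X `<=` _]hB !sprodA; apply: sprodS => //.
by apply: sprodS => //; exact: gcomp_mul.
Qed.

Fact smash_idem : idem_set [set: smash B].
Proof.
apply/seteqP; split=> // a _.
apply: (smash_sum_in (submodule_sprod _ _) (fun r s => BS (r^-1 * s))) => [|r s].
  move=> r s x Bx _; have : (Bc (r^-1 * r) *s Bc (r^-1 * s)) x.
    by rewrite mulVg; exact: B3.
  by apply: (@single_sprod _ _ _ r r s (submodule_sprod _ _)) => // *; exact: mem_sprod.
exact: entryP.
Qed.

Fact psmash_idem : idem_set psmash.
Proof.
have [IS IM] := psmash_ideal.
apply/seteqP; split; first by apply: sprod_sub => // x y Ix _; exact: (IM _ _ Ix).1.
move=> a Ia; apply: (smash_sum_in (submodule_sprod _ _)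
  (fun r s => pS (Bc r^-1) (Bc s))) => //.
move=> r s x Bx Hx.
have : ((Bc r^-1 *s Bc r) *s (Bc r^-1 *s Bc s)) x.
  move: Hx; rewrite {1}hB invgK -!sprodA; exact.
apply: (@single_sprod _ _ _ r r s (submodule_sprod _ _) (pS _ _) (pS _ _))
  => {Hx}.
- by apply: sprod_sub => // u v; exact: BM.
- by apply: sprod_sub => // u v; exact: BM.
move=> {}x y {}Bx By Ux Vy; apply: mem_sprod.
  exact: (entry_single Bx (S := fun r s => Bc r^-1 *s Bc s)).
exact: (entry_single By (S := fun r s => Bc r^-1 *s Bc s)).
Qed.

Let act_psmash t : smash_action t @` psmash =
  [set a | forall r s, (Bc (r^-1 * t) *s Bc (t^-1 * s)) (entry a r s)].
Proof.
apply/seteqP; split=> [_ [a Ia <-] r s|a Ha].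
  by have := Ia (t^-1 * r)%g (t^-1 * s)%g; rewrite invgM invgK.
exists (smash_action t^-1%g a); last by rewrite gactVK.
move=> r s; rewrite smash_actE invgK.
by have := Ha (t * r)%g (t * s)%g; rewrite invgM mulgVK mulKg.
Qed.

(* Both products equal the ideal with (r, s)-entries in                       *)
(* B_{r^-1} B_t B_{t^-1} B_s.                                                 *)
Let Kt t : set (smash B) :=
  [set a | forall r s,
     (Bc r^-1 *s Bc t *s (Bc t^-1 *s Bc s)) (entry a r s)].
Let Kt_submodule t : submodule (Kt t).
Proof.
split=> [r s|c a b Ia Ib r s]; first exact: submodule0.
by rewrite entryL; apply: (pS _ _).2.
Qed.

Let psmash_mull t : psmash *s (smash_action t @` psmash) = Kt t.
Proof.
rewrite act_psmash; apply/seteqP; split.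
  apply: sprod_sub => // a b Ia Jb r s; apply: entry_mul_in => // u.
  have := mem_sprod (Ia r u) (Jb u s).
  rewrite -[in X in X -> _]sprodA (sprodA (Bc u)) => H.
  have : (Bc r^-1 *s (Bc t *s Bc (t^-1 * s))) (entry a r u *a entry b u s).
    move: H; apply: sprodS => //; apply: sprodS => //.
    by apply: sprod_sub => // x y Bx By; have := BM Bx By; rewrite mulVKg.
  have : Bc t *s Bc (t^-1 * s) `<=` Bc t *s (Bc t^-1 *s Bc s).
    by have := @BBl t (t^-1 * s)%g; rewrite mulVKg.
  rewrite -[in X in _ -> _ -> X]sprodA => sub.
  exact: sprodS.
move=> a Ka; apply: (smash_sum_in (submodule_sprod _ _)
  (fun r s => pS (Bc r^-1 *s Bc t) (Bc t^-1 *s Bc s)) _ Ka) => r s x Bx.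
apply: (@single_sprod _ _ _ r t s (submodule_sprod _ _) (pS _ _) (pS _ _)).
- by apply: sprod_sub => // u v; exact: BM.
- by apply: sprod_sub => // u v; exact: BM.
move=> {}x y {}Bx By Ux Vy; apply: mem_sprod.
  exact: (entry_single Bx (S := fun r s => Bc r^-1 *s Bc s)).
apply: (entry_single By (S := fun r s => Bc (r^-1 * t) *s Bc (t^-1 * s))) => //.
rewrite mulVg; move: y Vy {By}.
have : Bc t^-1 *s Bc s `<=` Bc 1 *s Bc (t^-1 * s).
  apply: (subset_trans (sprodS (@B3 t^-1%g) (@subset_refl _ (Bc s)))).
  by rewrite -sprodA; apply: sprodS => //; exact: gcomp_mul.
exact.
Qed.

Let psmash_mulr t : (smash_action t @` psmash) *s psmash = Kt t.
Proof.
rewrite act_psmash; apply/seteqP; split.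
  apply: sprod_sub => // a b Ja Ib r s; apply: entry_mul_in => // u.
  have := mem_sprod (Ja r u) (Ib u s).
  rewrite [in X in X -> _]sprodA -[in X in X -> _](sprodA _ _ (Bc u^-1)) => H.
  have : (Bc (r^-1 * t) *s Bc t^-1 *s Bc s) (entry a r u *a entry b u s).
    move: H; apply: sprodS => //; apply: sprodS => //.
    by apply: sprod_sub => // x y Bx By; have := BM Bx By; rewrite mulgK.
  have : Bc (r^-1 * t) *s Bc t^-1 `<=` Bc r^-1 *s Bc t *s Bc t^-1.
    by have := @BBr (r^-1 * t)%g t^-1%g; rewrite mulgK invgK.
  rewrite [in X in _ -> _ -> X]sprodA => sub.
  exact: sprodS.
move=> a Ka; apply: (smash_sum_in (submodule_sprod _ _)
  (fun r s => pS (Bc r^-1 *s Bc t) (Bc t^-1 *s Bc s)) _ Ka) => r s x Bx.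
apply: (@single_sprod _ _ _ r t s (submodule_sprod _ _) (pS _ _) (pS _ _)).
- by apply: sprod_sub => // u v; exact: BM.
- by apply: sprod_sub => // u v; exact: BM.
move=> {}x y {}Bx By Ux Vy; apply: mem_sprod; last first.
  exact: (entry_single By (S := fun r s => Bc r^-1 *s Bc s)).
apply: (entry_single Bx (S := fun r s => Bc (r^-1 * t) *s Bc (t^-1 * s))) => //.
rewrite mulVg; move: x Ux {Bx}.
have : Bc r^-1 *s Bc t `<=` Bc (r^-1 * t) *s Bc 1.
  apply: (subset_trans (sprodS (@subset_refl _ (Bc r^-1)) (@B3r t))).
  by rewrite sprodA; apply: sprodS => //; exact: gcomp_mul.
exact.
Qed.

Fact psmash_comm t : psmash *s (smash_action t @` psmash) =
  (smash_action t @` psmash) *s psmash.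
Proof. by rewrite psmash_mull psmash_mulr. Qed.

(* beta^B, as a product partial action of G on B # G *)
Definition smash_pact : partialAction G (smash B) :=
  global_pact smash_action smash_idem.

(* gamma^B *)
Definition canonical_pact : partialAction G psmash_alg :=
  restr_pact psmash_ideal psmash_idem psmash_comm.

End PartialSmash.

HB.mixin Record Lmodule_isBimodule (k : comPzRingType) (A B : nuAlgType k) X
    of GRing.Lmodule k X := {
  lact : A -> X -> X;
  ract : X -> B -> X;
  lactLl : forall (c : k) a a' x,
    lact (c *: a + a') x = c *: lact a x + lact a' x;
  lactLr : forall (c : k) a x x',
    lact a (c *: x + x') = c *: lact a x + lact a x';
  ractLl : forall (c : k) x x' b,
    ract (c *: x + x') b = c *: ract x b + ract x' b;
  ractLr : forall (c : k) x b b',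
    ract x (c *: b + b') = c *: ract x b + ract x b';
  lactA : forall a a' x, lact (a *a a') x = lact a (lact a' x);
  ractA : forall x b b', ract x (b *a b') = ract (ract x b) b';
  lractA : forall a x b, ract (lact a x) b = lact a (ract x b)
}.

#[short(type="bimodType")]
HB.structure Definition Bimodule (k : comPzRingType) (A B : nuAlgType k) :=
  {X of Lmodule_isBimodule k A B X & GRing.Lmodule k X}.

Notation "a *L x" := (lact a x) (at level 40, left associativity) : ring_scope.
Notation "x *R b" := (ract x b) (at level 40, left associativity) : ring_scope.

(* The tensor product over a not necessarily unital algebra B: the free       *)
(* k-module on X * Y modulo k-bilinearity and B-balancedness.                 *)
Section Tensor.
Context {k : comPzRingType} {A B C : nuAlgType k}.
Context (X : bimodType A B) (Y : bimodType B C).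

Local Notation free := (fs (X * Y)%type k^o).
Definition tens_gen (x : X) (y : Y) : free := single (x, y) (1 : k^o).

Definition tens_rel : set free := [set r |
  [\/ exists c x x' y,
        r = tens_gen (c *: x + x') y - (c *: tens_gen x y + tens_gen x' y),
      exists c x y y',
        r = tens_gen x (c *: y + y') - (c *: tens_gen x y + tens_gen x y') |
      exists x b y, r = tens_gen (x *R b) y - tens_gen x (b *L y)]].

Definition tensor := quotm (submodule_lspan tens_rel).
HB.instance Definition _ := GRing.Lmodule.on tensor.

Definition tens (x : X) (y : Y) : tensor := qpi _ (tens_gen x y).

Lemma tensLl c x x' y : tens (c *: x + x') y = c *: tens x y + tens x' y.
Proof.
rewrite /tens -linearP; apply/qpi_eq; apply: (@sub_lspan _ _ tens_rel).
apply: Or31.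
by exists c, x, x', y.
Qed.
Lemma tensLr c x y y' : tens x (c *: y + y') = c *: tens x y + tens x y'.
Proof.
rewrite /tens -linearP; apply/qpi_eq; apply: (@sub_lspan _ _ tens_rel).
apply: Or32.
by exists c, x, y, y'.
Qed.
Lemma tens_balanced x b y : tens (x *R b) y = tens x (b *L y).
Proof.
apply/qpi_eq; apply: (@sub_lspan _ _ tens_rel).
by apply: Or33; exists x, b, y.
Qed.

Lemma tens_ind (P : tensor -> Prop) : P 0 ->
  (forall c u v, P u -> P v -> P (c *: u + v)) -> (forall x y, P (tens x y)) ->
  forall u, P u.
Proof.
move=> P0 PL Pt u; rewrite -(qpi_repr u); set f := repr u.
have [r _ [_ ->]] := fs_decomp (f : free).
elim/big_ind: _ => [|g h Pg Ph|[x y] _].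
- by rewrite linear0.
- by have := PL 1 _ _ Pg Ph; rewrite scale1r -qpiD.
rewrite [X in P X](_ : _ = (f : free) (x, y) *: tens x y + 0).
  exact: PL.
rewrite addr0 -linearZ; congr (qpi _ _); apply/fsP => p; rewrite fsZE !singleE.
by case: eqP => _; rewrite ?scaler0// [RHS]mulr1.
Qed.

Section Lift.
Context {W : lmodType k} (phi : X -> Y -> W).
Hypothesis phiLl : forall c x x' y,
  phi (c *: x + x') y = c *: phi x y + phi x' y.
Hypothesis phiLr : forall c x y y',
  phi x (c *: y + y') = c *: phi x y + phi x y'.
Hypothesis phi_balanced : forall x b y, phi (x *R b) y = phi x (b *L y).

Let free_lift (f : free) : W :=
  fs_sum (fun p (c : k^o) => (c : k) *: phi p.1 p.2) f.

Let free_lift_linear : linear free_lift.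
Proof.
move=> c f g; apply: fs_sum_linear => p; first by rewrite scale0r.
by rewrite scalerDl scalerA.
Qed.

Let free_lift_gen x y : free_lift (tens_gen x y) = phi x y.
Proof.
by rewrite /free_lift fs_sum_single ?scale1r// => p; rewrite scale0r.
Qed.

Let free_liftB f g : free_lift (f - g) = free_lift f - free_lift g.
Proof.
by have := free_lift_linear (-1) g f; rewrite !scaleN1r [f - g]addrC => ->; rewrite addrC.
Qed.

Let free_lift_rel f : lspan tens_rel f -> free_lift f = 0.
Proof.
move: f; apply: lspan_ind => [|c f g Ef Eg|f].
- by apply: fs_sum0 => p; rewrite scale0r.
- by rewrite free_lift_linear Ef Eg scaler0 addr0.
case=> [[c [x [x' [y ->]]]]|[c [x [y [y' ->]]]]|[x [b [y ->]]]].
- by rewrite free_liftB free_lift_linear !free_lift_gen phiLl subrr.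
- by rewrite free_liftB free_lift_linear !free_lift_gen phiLr subrr.
- by rewrite free_liftB !free_lift_gen phi_balanced subrr.
Qed.

Definition tens_lift (u : tensor) : W := free_lift (repr u).

Let tens_lift_qpi f : tens_lift (qpi _ f) = free_lift f.
Proof.
apply/eqP; rewrite -subr_eq0 -free_liftB; apply/eqP/free_lift_rel.
by apply/(qpi_eq (submodule_lspan tens_rel)); rewrite qpi_repr.
Qed.

Lemma tens_lift_linear : linear tens_lift.
Proof.
move=> c u v; rewrite -(qpi_repr u) -(qpi_repr v) -linearP !tens_lift_qpi.
exact: free_lift_linear.
Qed.

Lemma tens_liftE x y : tens_lift (tens x y) = phi x y.
Proof. by rewrite /tens tens_lift_qpi free_lift_gen. Qed.
End Lift.

(* a(x (x) y) = (ax) (x) y and (x (x) y)c = x (x) (yc) *)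
Definition tens_lact (a : A) : tensor -> tensor :=
  tens_lift (fun x y => tens (a *L x) y).
Definition tens_ract (u : tensor) (c : C) : tensor :=
  tens_lift (fun x y => tens x (y *R c)) u.

Fact tens_lact_linear a : linear (tens_lact a).
Proof.
apply: tens_lift_linear => [c x x' y|c x y y'|x b y].
- by rewrite lactLr tensLl.
- by rewrite tensLr.
- by rewrite -lractA tens_balanced.
Qed.
Lemma tens_lactE a x y : tens_lact a (tens x y) = tens (a *L x) y.
Proof.
apply: tens_liftE => {x y}[c x x' y|c x y y'|x b y].
- by rewrite lactLr tensLl.
- by rewrite tensLr.
- by rewrite -lractA tens_balanced.
Qed.
Fact tens_ract_linear c : linear (tens_ract ^~ c).
Proof.
apply: tens_lift_linear => [d x x' y|d x y y'|x b y].
- by rewrite tensLl.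
- by rewrite ractLl tensLr.
- by rewrite lractA tens_balanced.
Qed.
Lemma tens_ractE x y c : tens_ract (tens x y) c = tens x (y *R c).
Proof.
apply: tens_liftE => {x y}[d x x' y|d x y y'|x b y].
- by rewrite tensLl.
- by rewrite ractLl tensLr.
- by rewrite lractA tens_balanced.
Qed.

Let linear_zero (U V : lmodType k) (f : U -> V) : linear f -> f 0 = 0.
Proof.
by move=> fL; have := fL (-1) 0 0; rewrite scaler0 add0r scaleN1r addNr.
Qed.

Lemma tens_ext (W : lmodType k) (f g : tensor -> W) : linear f -> linear g ->
  (forall x y, f (tens x y) = g (tens x y)) -> f =1 g.
Proof.
move=> fL gL fg; apply: tens_ind => [|c u v Eu Ev|//].
  by rewrite !linear_zero.
by rewrite fL gL Eu Ev.
Qed.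

Fact tens_lactLl (c : k) a a' u :
  tens_lact (c *: a + a') u = c *: tens_lact a u + tens_lact a' u.
Proof.
move: u; apply: tens_ext => [|d u v|x y]; first exact: tens_lact_linear.
  by rewrite !tens_lact_linear !scalerDr !scalerA [d * c]mulrC addrACA.
by rewrite !tens_lactE lactLl tensLl.
Qed.
Fact tens_ractLr (c : k) u b b' :
  tens_ract u (c *: b + b') = c *: tens_ract u b + tens_ract u b'.
Proof.
move: u; apply: tens_ext => [|d u v|x y]; first exact: tens_ract_linear.
  by rewrite !tens_ract_linear !scalerDr !scalerA [d * c]mulrC addrACA.
by rewrite !tens_ractE ractLr tensLr.
Qed.
Fact tens_lactA a a' u : tens_lact (a *a a') u = tens_lact a (tens_lact a' u).
Proof.
move: u; apply: tens_ext => [|d u v|x y]; first exact: tens_lact_linear.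
  by rewrite !tens_lact_linear.
by rewrite !tens_lactE lactA.
Qed.
Fact tens_ractA u b b' : tens_ract u (b *a b') = tens_ract (tens_ract u b) b'.
Proof.
move: u; apply: tens_ext => [|d u v|x y]; first exact: tens_ract_linear.
  by rewrite !tens_ract_linear.
by rewrite !tens_ractE ractA.
Qed.
Fact tens_lractA a u b :
  tens_ract (tens_lact a u) b = tens_lact a (tens_ract u b).
Proof.
move: u; apply: tens_ext => [d u v|d u v|x y].
- by rewrite tens_lact_linear tens_ract_linear.
- by rewrite tens_ract_linear tens_lact_linear.
by rewrite !(tens_lactE, tens_ractE).
Qed.

HB.instance Definition _ := Lmodule_isBimodule.Build k A C tensor
  tens_lactLl (fun c a => tens_lact_linear a c)
  (fun d u v c => tens_ract_linear c d u v) tens_ractLr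
  tens_lactA tens_ractA tens_lractA.

End Tensor.

(* A bimodule map from an A-bimodule to the A-bimodule A. *)
Definition bimod_map_to_alg (k : comPzRingType) (A : nuAlgType k)
    (M : bimodType A A) (f : M -> A) : Prop :=
  [/\ linear f, forall a u, f (a *L u) = a *a f u &
      forall u a, f (u *R a) = f u *a a].

Record moritaContext (k : comPzRingType) (A B : nuAlgType k) := MoritaContext {
  mcX : bimodType A B;
  mcY : bimodType B A;
  tauA : tensor mcX mcY -> A;
  tauB : tensor mcY mcX -> B;
  tauA_map : bimod_map_to_alg tauA;
  tauB_map : bimod_map_to_alg tauB;
  tauAB : forall x y x', tauA (tens x y) *L x' = x *R tauB (tens y x');
  tauBA : forall y x y', tauB (tens y x) *L y' = y *R tauA (tens x y')
}.
Arguments tauA {k A B}.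
Arguments tauB {k A B}.

Definition unital_bimodule (k : comPzRingType) (A B : nuAlgType k)
    (X : bimodType A B) : Prop :=
  lspan [set a *L x | a in [set: A] & x in [set: X]] = [set: X] /\
  lspan [set x *R b | x in [set: X] & b in [set: B]] = [set: X].

Section GradedMorita.
Context {k : comPzRingType} {G : groupType}.

Definition graded_bimodule (A B : gradedAlg k G) (X : bimodType A B)
    (X_ : G -> set X) : Prop :=
  [/\ direct_sum X_,
      forall s t a x, gcomp A s a -> X_ t x -> X_ (s * t)%g (a *L x) &
      forall s t x b, X_ s x -> gcomp B t b -> X_ (s * t)%g (x *R b)].

Definition graded_morita (A B : gradedAlg k G) (M : moritaContext A B)
    (X_ : G -> set (mcX M)) (Y_ : G -> set (mcY M)) : Prop :=
  [/\ graded_bimodule X_, graded_bimodule Y_,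
      forall r s, tauA M @` lspan [set tens x y | x in X_ r & y in Y_ s]
                  `<=` gcomp A (r * s)%g &
      forall r s, tauB M @` lspan [set tens y x | y in Y_ r & x in X_ s]
                  `<=` gcomp B (r * s)%g].

(* The notion is only defined between idempotent algebras, hence the first two *)
(* conditions.                                                                *)
Definition graded_equivalent (A B : gradedAlg k G) : Prop :=
  [/\ idem_set [set: A], idem_set [set: B] &
      exists (M : moritaContext A B) X_ Y_,
        [/\ graded_morita (M := M) X_ Y_,
            unital_bimodule (mcX M), unital_bimodule (mcY M),
            range (tauA M) = [set: A] & range (tauB M) = [set: B]]].

End GradedMorita.

(* Main.v *)
From HB Require Import structures.
From mathcomp Require Import all_boot all_algebra finmap.
From mathcomp Require Import boolp classical_sets functions cardinality fsbigop.
Require Import Defs.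

Set Implicit Arguments.
Unset Strict Implicit.
Unset Printing Implicit Defensive.
Import GRing.Theory.
Local Open Scope classical_set_scope.
Local Open Scope ring_scope.

(** Write [al] for the global action [be] of [G] on [A], [I] for an idempotent
ideal of [A] commuting with its translates [J t = be t @` I], and [ga] for the
partial action of [G] on [I] obtained by restriction.  Everything takes place
inside the single algebra [R = skew al].  The skew group algebra of [ga] sits
in [R] as the elements whose [t]-th coefficient lies in [I *s J t]
([range_skew_incl]); it is the corner of [R] cut out by [I], and the modules
linking it to [R] are what would be [R e] and [e R] if [I] had a unit [e]:
- [X], the elements with [t]-th coefficient in [J t], playing the part of [R e];
- [Y], the elements with all coefficients in [I], playing the part of [e R].
Since [(a delta_r)(b delta_s) = a be_r(b) delta_(rs)], products of such sets are
computed on coefficients ([coef_in_sprod]), which gives [R X = X], [Y R = Y] and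
[Y X = skew ga].  The last identity needed, [X Y = R], has coefficients
[\sum_t J t = A]: it says that the translates of [I] span [A].

These four identities already make [X], [Y] and the multiplication of [R] a
graded Morita equivalence ([graded_equivalent_sub]): unitality of the remaining
two actions and idempotence of both algebras follow from them by associativity.

For the smash product, [I^B] has [(r, s)]-entries in [B_(r^-1) B_s], so its
translate by [r] has [(r, s)]-entries in [B_1 B_(r^-1 s)], which is all of
[B_(r^-1 s)] for partially-strongly-graded [B]; hence the translates of [I^B]
span [B # G] ([psmash_translates_span]). *)

(** * Pairings of bimodules and the tensor product *)

Lemma linear_fun0 (k : pzRingType) (U V : lmodType k) (f : U -> V) :
  linear f -> f 0 = 0.
Proof.
by move=> fL; have := fL (-1) 0 0; rewrite scaler0 add0r scaleN1r addNr.
Qed.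

Section Pairings.
Context {k : comPzRingType} {A B : nuAlgType k}.
Context {X : bimodType A B} {Y : bimodType B A}.

(** The data on pairs [(x, y)] of a bimodule map from [X (x)_B Y] to [A]. *)
Definition bimod_pairing (phi : X -> Y -> A) : Prop :=
  [/\ forall c x x' y, phi (c *: x + x') y = c *: phi x y + phi x' y,
      forall c x y y', phi x (c *: y + y') = c *: phi x y + phi x y',
      forall x b y, phi (x *R b) y = phi x (b *L y),
      forall a x y, phi (a *L x) y = a *a phi x y &
      forall x y a, phi x (y *R a) = phi x y *a a].

Context {phi : X -> Y -> A} (phiP : bimod_pairing phi).

Lemma pairing_liftE x y : tens_lift phi (tens x y) = phi x y.
Proof. by case: phiP => *; exact: tens_liftE. Qed.

Lemma pairing_lift_linear : linear (tens_lift phi).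
Proof. by case: phiP => *; exact: tens_lift_linear. Qed.

Lemma pairing_lift_map : bimod_map_to_alg (tens_lift phi).
Proof.
have [_ _ _ phil phir] := phiP; have phiL := pairing_lift_linear.
split=> // [a u|u a]; move: u; apply: tens_ext => [c u v|c u v|x y].
- by rewrite lactLr phiL.
- by rewrite phiL amulDr amulZr.
- by rewrite [_ *L _]tens_lactE !pairing_liftE phil.
- by rewrite ractLl phiL.
- by rewrite phiL amulDl amulZl.
- by rewrite [_ *R _]tens_ractE !pairing_liftE phir.
Qed.

Lemma pairing_lift_sub (U : set X) (V : set Y) (N : set A) : submodule N ->
  (forall x y, U x -> V y -> N (phi x y)) ->
  tens_lift phi @` lspan [set tens x y | x in U & y in V] `<=` N.
Proof.
move=> NS UVN _ [u + <-]; move: u; apply: lspan_ind => [|c u v Nu Nv|].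
- by rewrite (linear_fun0 pairing_lift_linear); exact: submodule0.
- by rewrite pairing_lift_linear; exact: NS.2.
- by move=> _ [x Ux [y Vy <-]]; rewrite pairing_liftE; exact: UVN.
Qed.

Lemma submodule_pairing_range : submodule (range (tens_lift phi)).
Proof.
split=> [|c _ _ [u _ <-] [v _ <-]].
  by exists 0; rewrite ?(linear_fun0 pairing_lift_linear).
by exists (c *: u + v) => //; exact: pairing_lift_linear.
Qed.

Lemma pairing_range x y : range (tens_lift phi) (phi x y).
Proof. by exists (tens x y); rewrite ?pairing_liftE. Qed.

End Pairings.

(** * Bimodules inside an ambient algebra *)

Section SubBimodules.
Context {k : comPzRingType} {A B P : nuAlgType k}.

(** [A] and [B] act on [M] by multiplication in the ambient algebra [P], through
homomorphisms [f] and [g]; these need not be inclusions of subsets, so that the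
same construction serves for [R] acting on itself and for an embedded copy of
another algebra. *)
Definition sub_bimodule (f : A -> P) (g : B -> P) (M : set P) : Prop :=
  [/\ alg_hom f, alg_hom g, submodule M,
      forall a x, M x -> M (f a *a x) & forall x b, M x -> M (x *a g b)].

Context {f : A -> P} {g : B -> P} {M : set P} (HM : sub_bimodule f g M).

Fact sub_bimodule_submodule : submodule M. Proof. by case: HM. Qed.
Fact sub_bimodule_lin a x : M x -> M (f a *a x).
Proof. by case: HM => _ _ _ + _; exact. Qed.
Fact sub_bimodule_rin x b : M x -> M (x *a g b).
Proof. by case: HM => _ _ _ _; exact. Qed.

Definition sub_bimod := subm sub_bimodule_submodule.
HB.instance Definition _ := SubType.on sub_bimod.
HB.instance Definition _ := GRing.Lmodule.on sub_bimod.

Definition sub_lact (a : A) (x : sub_bimod) : sub_bimod :=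
  mksub sub_bimodule_submodule (sub_bimodule_lin a (submP x)).
Definition sub_ract (x : sub_bimod) (b : B) : sub_bimod :=
  mksub sub_bimodule_submodule (sub_bimodule_rin b (submP x)).

Fact sub_lactLl (c : k) a a' x :
  sub_lact (c *: a + a') x = c *: sub_lact a x + sub_lact a' x.
Proof.
have [[fL _] _ _ _ _] := HM.
by apply: val_inj; rewrite /= fL amulDl amulZl.
Qed.
Fact sub_lactLr (c : k) a x x' :
  sub_lact a (c *: x + x') = c *: sub_lact a x + sub_lact a x'.
Proof. by apply: val_inj; rewrite /= amulDr amulZr. Qed.
Fact sub_ractLl (c : k) x x' b :
  sub_ract (c *: x + x') b = c *: sub_ract x b + sub_ract x' b.
Proof. by apply: val_inj; rewrite /= amulDl amulZl. Qed.
Fact sub_ractLr (c : k) x b b' :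
  sub_ract x (c *: b + b') = c *: sub_ract x b + sub_ract x b'.
Proof.
have [_ [gL _] _ _ _] := HM.
by apply: val_inj; rewrite /= gL amulDr amulZr.
Qed.
Fact sub_lactA a a' x : sub_lact (a *a a') x = sub_lact a (sub_lact a' x).
Proof.
by have [[_ fM] _ _ _ _] := HM; apply: val_inj; rewrite /= fM amulA.
Qed.
Fact sub_ractA x b b' : sub_ract x (b *a b') = sub_ract (sub_ract x b) b'.
Proof.
by have [_ [_ gM] _ _ _] := HM; apply: val_inj; rewrite /= gM amulA.
Qed.
Fact sub_lractA a x b :
  sub_ract (sub_lact a x) b = sub_lact a (sub_ract x b).
Proof. by apply: val_inj; rewrite /= amulA. Qed.
HB.instance Definition _ := Lmodule_isBimodule.Build k A B sub_bimod
  sub_lactLl sub_lactLr sub_ractLl sub_ractLr sub_lactA sub_ractA sub_lractA.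

Definition bval (x : sub_bimod) : P := val x.
Definition mkbim x (Mx : M x) : sub_bimod := mksub sub_bimodule_submodule Mx.

Lemma bvalP x : M (bval x). Proof. exact: submP. Qed.
Lemma bval_inj : injective bval. Proof. exact: val_inj. Qed.
Lemma bval_lact a x : bval (a *L x) = f a *a bval x. Proof. by []. Qed.
Lemma bval_ract x b : bval (x *R b) = bval x *a g b. Proof. by []. Qed.
Lemma bvalL c x y : bval (c *: x + y) = c *: bval x + bval y.
Proof. by []. Qed.
Lemma bval0 : bval 0 = 0. Proof. by []. Qed.
Lemma bval_sum I (r : seq I) (F : I -> sub_bimod) :
  bval (\sum_(i <- r) F i) = \sum_(i <- r) bval (F i).
Proof. by elim/big_rec2: _ => //= i x y _ <-. Qed.

(** Unitality is a statement about spans in the module type; it is transported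
to an equality of spans in the ambient algebra, where it can be computed. *)
Lemma sub_bimod_unital :
  range f *s M = M -> M *s range g = M -> unital_bimodule sub_bimod.
Proof.
move=> fM Mg.
have lift (S : set sub_bimod) :
    M `<=` bval @` lspan S -> lspan S = [set: sub_bimod].
  move=> MS; apply/seteqP; split=> // x _.
  by have [y Sy /bval_inj <-] := MS _ (bvalP x).
have imS (S : set sub_bimod) : submodule (bval @` lspan S).
  have [S0 SL] := @submodule_lspan _ _ S.
  split=> [|c _ _ [x Sx <-] [y Sy <-]]; first by exists 0.
  by exists (c *: x + y) => //; exact: SL.
split; apply: lift.
  rewrite -[X in X `<=` _]fM; apply: sprod_sub => // _ x [a _ <-] Mx.
  exists (a *L mkbim Mx) => //; apply: sub_lspan.
  by exists a => //; exists (mkbim Mx).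
rewrite -[X in X `<=` _]Mg; apply: sprod_sub => // x _ Mx [b _ <-].
exists (mkbim Mx *R b) => //; apply: sub_lspan.
by exists (mkbim Mx) => //; exists b.
Qed.

End SubBimodules.

(** * Graded Morita equivalence inside one graded algebra *)

Definition homogeneous (k : comPzRingType) (G : groupType) (R : gradedAlg k G)
    (M : set R) : Prop :=
  forall h : fs G R, (forall t, gcomp R t (h t)) ->
    M (\sum_(t \in [set: G]) h t) -> forall t, M (h t).

(** Homogeneity says that the components in [R] of an element of [M] lie again
in [M], so the decomposition in [R] is a decomposition in [M]; its uniqueness is
inherited. *)
Lemma sub_bimod_direct_sum (k : comPzRingType) (G : groupType)
    (R : gradedAlg k G) (A B : nuAlgType k) (f : A -> R) (g : B -> R)
    (M : set R) (HM : sub_bimodule f g M) : homogeneous M ->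
  direct_sum (fun t => [set x : sub_bimod HM | gcomp R t (bval x)]).
Proof.
move=> Mh; split=> [t|x].
  split=> [|c x y Rx Ry] /=; first exact: (submodule0 (gcomp_submodule R t)).
  by rewrite bvalL; exact: (gcomp_submodule R t).2.
have [h [[hR xE] h_uniq]] := (gcomp_sum R).2 (bval x).
have hM t : M (h t) by apply: Mh => //; rewrite -xE; exact: bvalP.
have Hfin : fin_supp (fun t => mkbim HM (hM t)).
  apply: (sub_finite_set _ (fs_finite h)) => t /= ht h0; apply: ht.
  exact: val_inj.
have bsum (H : fs G (sub_bimod HM)) :
    bval (\sum_(t \in [set: G]) H t) = \sum_(t \in [set: G]) bval (H t).
  have [Z HZ] := fs_supp H.
  rewrite (fsbigTE Z)// bval_sum (fsbigTE Z)// => t /HZ ->.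
  exact: bval0.
exists (mkfs Hfin); split=> [|H [HR HE]].
  split=> [t|]; first exact: hR.
  by apply: bval_inj; rewrite bsum.
have Hfin' : fin_supp (fun t => bval (H t)).
  apply: (sub_finite_set _ (fs_finite H)) => t /= ht H0; apply: ht.
  by rewrite H0.
have hE : h = mkfs Hfin' by apply: h_uniq; split=> //; rewrite HE bsum.
apply/fsP => t; apply: bval_inj.
by rewrite [LHS](_ : _ = h t)// hE.
Qed.

(** Four identities suffice because the others are consequences of them:
[X S = X Y X = R X = X], [S Y = Y X Y = Y R = Y], [R R = R X Y = X Y = R] and
[S S = S Y X = Y X = S].  Both pairings are the multiplication of [R], hence the
compatibilities between them are instances of associativity. *)
Lemma graded_equivalent_sub (k : comPzRingType) (G : groupType)
    (R S : gradedAlg k G) (iota : S -> R) (X Y : set R) :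
  alg_hom iota -> injective iota ->
  (forall t s, gcomp S t s <-> gcomp R t (iota s)) ->
  homogeneous X -> homogeneous Y ->
  [set: R] *s X = X -> Y *s [set: R] = Y ->
  X *s Y = [set: R] -> Y *s X = range iota ->
  graded_equivalent R S.
Proof.
move=> iotaH iotaI iotaG Xh Yh RX YR XY YX.
have [iL iM] := iotaH.
have XS : X *s range iota = X by rewrite -YX sprodA XY.
have SY : range iota *s Y = Y by rewrite -YX -sprodA XY.
have RR : [set: R] *s [set: R] = [set: R] by rewrite -{2}XY sprodA RX.
have SS : [set: S] *s [set: S] = [set: S].
  apply/seteqP; split=> // s _.
  have : range iota (iota s) by exists s.
  have {1}-> : range iota = iota @` ([set: S] *s [set: S]).
    by rewrite (image_sprod _ _ iotaH) -{3}YX sprodA SY YX.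
  by case=> s' Ss' /iotaI <-.
have XM : submodule X by rewrite -RX; exact: submodule_sprod.
have YM : submodule Y by rewrite -YR; exact: submodule_sprod.
have HX : sub_bimodule id iota X.
  split=> // [a x Xx|x b Xx]; first by rewrite -RX; exact: mem_sprod.
  by rewrite -XS; apply: mem_sprod => //; exists b.
have HY : sub_bimodule iota id Y.
  split=> // [b y Yy|y a Yy]; last by rewrite -YR; exact: mem_sprod.
  by rewrite -SY; apply: mem_sprod => //; exists b.
pose BX : bimodType R S := sub_bimod HX.
pose BY : bimodType S R := sub_bimod HY.
pose phiA (x : BX) (y : BY) : R := bval x *a bval y.
have YXS (y : BY) (x : BX) : exists s, iota s = bval y *a bval x.
  have : (Y *s X) (bval y *a bval x) by apply: mem_sprod; exact: bvalP.
  by rewrite YX => -[s _ <-]; exists s.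
pose phiB (y : BY) (x : BX) : S := projT1 (cid (YXS y x)).
have phiBE y x : iota (phiB y x) = bval y *a bval x.
  exact: projT2 (cid (YXS y x)).
have PA : bimod_pairing phiA.
  split=> *; rewrite /phiA.
  - by rewrite bvalL amulDl amulZl.
  - by rewrite bvalL amulDr amulZr.
  - by rewrite bval_ract bval_lact amulA.
  - by rewrite bval_lact amulA.
  - by rewrite bval_ract amulA.
have PB : bimod_pairing phiB.
  split=> *; apply: iotaI; rewrite ?(iL, iM) !phiBE.
  - by rewrite bvalL amulDl amulZl.
  - by rewrite bvalL amulDr amulZr.
  - by rewrite bval_ract bval_lact amulA.
  - by rewrite bval_lact amulA.
  - by rewrite bval_ract amulA.
have tAB (x : BX) (y : BY) (x' : BX) :
    tens_lift phiA (tens x y) *L x' = x *R tens_lift phiB (tens y x').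
  apply: bval_inj; rewrite !pairing_liftE//.
  by rewrite bval_lact bval_ract phiBE amulA.
have tBA (y : BY) (x : BX) (y' : BY) :
    tens_lift phiB (tens y x) *L y' = y *R tens_lift phiA (tens x y').
  apply: bval_inj; rewrite !pairing_liftE//.
  by rewrite bval_lact bval_ract phiBE amulA.
split=> //.
exists (MoritaContext (pairing_lift_map PA) (pairing_lift_map PB) tAB tBA).
exists (fun t => [set x : BX | gcomp R t (bval x)]).
exists (fun t => [set y : BY | gcomp R t (bval y)]).
split.
- split.
  + split=> [|s t a x Ra Rx|s t x b Rx Sb]; first exact: sub_bimod_direct_sum.
      exact: mem_gcomp.
    by apply: mem_gcomp => //; exact/iotaG.
  + split=> [|s t b y Sb Ry|s t y a Ry Ra]; first exact: sub_bimod_direct_sum.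
      by apply: mem_gcomp => //; exact/iotaG.
    exact: mem_gcomp.
  + move=> r s; apply: (pairing_lift_sub PA); first exact: gcomp_submodule.
    by move=> x y; exact: mem_gcomp.
  + move=> r s; apply: (pairing_lift_sub PB); first exact: gcomp_submodule.
    by move=> y x Ry Rx; apply/iotaG; rewrite phiBE; exact: mem_gcomp.
- by apply: sub_bimod_unital => //; rewrite image_id.
- by apply: sub_bimod_unital => //; rewrite image_id.
- apply/seteqP; split=> //; rewrite -[X in X `<=` _]XY.
  apply: sprod_sub (submodule_pairing_range PA) _ => x y Xx Yy.
  exact: (pairing_range PA (mkbim HX Xx) (mkbim HY Yy)).
- apply/seteqP; split=> // s _.
  have : (iota @` range (tens_lift phiB)) (iota s).
    suff : Y *s X `<=` iota @` range (tens_lift phiB).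
      by apply; rewrite YX; exists s.
    apply: sprod_sub; first exact: image_submodule (submodule_pairing_range PB).
    move=> y x Yy Xx; exists (phiB (mkbim HY Yy) (mkbim HX Xx)).
      exact: (pairing_range PB).
    exact: phiBE.
  by case=> s' Hs' /iotaI <-.
Qed.

(** * Subsets of a skew group algebra given by coefficients *)

Section Coefficients.
Context {k : comPzRingType} {G : groupType} {A : nuAlgType k}.
Context (al : partialAction G A).
Implicit Types U : G -> set A.

Lemma skewP (f g : skew al) :
  (forall t, skew_fs f t = skew_fs g t) -> f = g.
Proof. by move=> fg; apply: val_inj; apply/fsP. Qed.

Lemma skew_fsL c (f g : skew al) t :
  skew_fs (c *: f + g) t = c *: skew_fs f t + skew_fs g t.
Proof. by []. Qed.

Definition coef_in U : set (skew al) :=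
  [set f | forall t, U t (skew_fs f t)].

Lemma submodule_coef_in U :
  (forall t, submodule (U t)) -> submodule (coef_in U).
Proof.
move=> US; split=> [t|c f g Uf Ug t]; first exact: submodule0.
exact: (US t).2 c _ _ (Uf t) (Ug t).
Qed.

Lemma coef_in_delta U t a (Da : pdom al t a) :
  (forall t, submodule (U t)) -> U t a -> coef_in U (delta Da).
Proof.
move=> US Ua s; rewrite /skew_fs /= singleE; case: eqP => [->//|_].
exact: submodule0.
Qed.

Lemma coef_in_sub U (N : set (skew al)) : submodule N ->
  (forall t a (Da : pdom al t a), U t a -> N (delta Da)) -> coef_in U `<=` N.
Proof.
move=> NS UN f Uf; have [X _ [_ fE]] := fs_decomp (skew_fs f).
have -> : f = \sum_(t <- X) delta (submP f t).
  by apply: val_inj; rewrite [RHS]skew_fs_sum -[LHS]/(skew_fs f) {1}fE.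
by apply: submodule_sum => // t; exact: UN.
Qed.

(** The component of degree [t] of an element is its [t]-th coefficient times
[delta_t]. *)
Lemma coef_in_homogeneous U : (forall t, submodule (U t)) ->
  @homogeneous _ _ (skew_graded al) (coef_in U).
Proof.
move=> US h hD Uh t s; have [a Da hE] := hD t.
have [<-|ts] := eqVneq t s; last first.
  by rewrite hE singleE eq_sym (negPf ts); exact: submodule0.
suff <- : skew_fs (\sum_(t \in [set: G]) h t) t = skew_fs (h t) t by exact: Uh.
have [Z hZ] := fs_supp h; rewrite (fsbigTE Z)// skew_fs_sum fs_sumE.
have ht t' : t' != t -> skew_fs (h t') t = 0.
  by move=> t't; have [a' _ ->] := hD t'; rewrite singleE eq_sym (negPf t't).
have [tZ|tZ] := boolP (t \in Z).
  by rewrite (bigD1_seq t) ?fset_uniq//= big1 ?addr0.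
rewrite big_seq big1 ?hZ// => t' t'Z.
by apply: ht; apply: contraNneq tZ => <-.
Qed.

End Coefficients.

(** * Products in the skew group algebra of a global action *)

Section GlobalSkew.
Context {k : comPzRingType} {G : groupType} {A : nuAlgType k}.
Context (be : algAction G A) (A_idem : idem_set [set: A]).
Local Notation al := (global_pact be A_idem).

(** For a global action all domains are [A], so [a delta_t] is defined for every
[a] and is linear in it. *)
Definition gdelta (t : G) (a : A) : skew al :=
  @delta _ _ _ al t a Logic.I.

Lemma gdelta_coef t a s : skew_fs (gdelta t a) s = if s == t then a else 0.
Proof. by []. Qed.

Lemma deltaE t a (Da : pdom al t a) : delta Da = gdelta t a.
Proof. exact: val_inj. Qed.

Lemma gdelta_linear t : linear (gdelta t).
Proof. by move=> c a b; apply: val_inj; rewrite /= linearP. Qed.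

Lemma gdeltaM r s a b :
  gdelta r a *a gdelta s b = gdelta (r * s)%g (a *a be r b).
Proof.
apply: val_inj; rewrite -[LHS]/(skew_fs _) skew_mul_delta /=.
by congr single; rewrite (gact_hom be r).2 gactVK.
Qed.

Lemma coef_in_gdelta (U : G -> set A) t a :
  (forall t, submodule (U t)) -> U t a -> coef_in (al := al) U (gdelta t a).
Proof. exact: coef_in_delta. Qed.

(** The product of the [r]-th and [s]-th coefficients contributes
[U r * be_r(V s)] in degree [r s].  The first inclusion bounds these
contributions by [W]; the second says that those in degree [t] span [W t]. *)
Lemma coef_in_sprod (U V W : G -> set A) :
  (forall t, submodule (U t)) -> (forall t, submodule (V t)) ->
  (forall t, submodule (W t)) ->
  (forall r s, U r *s (be r @` V s) `<=` W (r * s)%g) ->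
  (forall t, W t `<=`
     lspan [set a | exists r, (U r *s (be r @` V (r^-1 * t)%g)) a]) ->
  coef_in (al := al) U *s coef_in V = coef_in W.
Proof.
move=> US VS WS UVW WUV; have CW := submodule_coef_in al WS.
have pS := submodule_sprod (coef_in (al := al) U) (coef_in V).
apply/seteqP; split; last first.
  apply: coef_in_sub => // t a Da /WUV; rewrite deltaE => {Da}.
  have NS : submodule [set a | (coef_in U *s coef_in V) (gdelta t a)].
    split=> /= [|c x y Nx Ny]; last by rewrite gdelta_linear; exact: pS.2.
    by rewrite (linear_fun0 (gdelta_linear t)); exact: pS.1.
  apply: (lspan_sub NS) => {}a [r]; move: a; apply: sprod_sub => //.
  move=> u _ Uu [v Vv <-] /=.
  have -> : gdelta t (u *a be r v) = gdelta r u *a gdelta (r^-1 * t)%g v.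
    by rewrite gdeltaM mulVKg.
  by apply: mem_sprod; exact: coef_in_gdelta.
apply: sprod_sub => // f g Uf Vg; move: f Uf.
apply: coef_in_sub => [|r a Da Ua]; first exact: submodule_mulr.
move: g Vg; apply: coef_in_sub => [|s b Db Vb]; first exact: submodule_mull.
rewrite /= !deltaE gdeltaM; apply: coef_in_gdelta => //; apply: UVW.
by apply: mem_sprod => //; exists b.
Qed.

End GlobalSkew.

(** * Restricting a global action to an ideal whose translates span *)

Section Globalization.
Context {k : comPzRingType} {G : groupType} {A : nuAlgType k}.
Context {be : algAction G A} (A_idem : idem_set [set: A]).
Context {I : set A} (HI : ideal I) (I_idem : idem_set I).
Context (I_comm : forall t, I *s (be t @` I) = (be t @` I) *s I).
Local Notation al := (global_pact be A_idem).
Local Notation ga := (restr_pact HI I_idem I_comm).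
Local Notation J t := (be t @` I).

Lemma skew_incl_fin (f : skew ga) :
  fin_supp (fun t => sval_alg (skew_fs f t)).
Proof.
apply: (sub_finite_set _ (fs_finite (skew_fs f))) => t /= ft f0; apply: ft.
by rewrite f0.
Qed.

Definition skew_incl (f : skew ga) : skew al :=
  @mksub _ _ _ (skew_submodule al) (mkfs (skew_incl_fin f))
    (fun=> Logic.I).

Lemma skew_inclE f t : skew_fs (skew_incl f) t = sval_alg (skew_fs f t).
Proof. by []. Qed.

Lemma skew_incl_linear : linear skew_incl.
Proof.
move=> c f g; apply: skewP => t.
by rewrite skew_fsL !skew_inclE skew_fsL svalL.
Qed.

Lemma skew_incl_inj : injective skew_incl.
Proof.
move=> f g fg; apply: skewP => t; apply: sval_inj.
by rewrite -skew_inclE fg.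
Qed.

Lemma skew_incl_delta t x (Dx : pdom ga t x) :
  skew_incl (delta Dx) = gdelta be A_idem t (sval_alg x).
Proof.
apply: skewP => s; rewrite skew_inclE gdelta_coef.
by rewrite [skew_fs _ _]singleE; case: eqP.
Qed.

(** The two multiplications are given by the same formula in terms of the two
actions, so it is enough that the partial action, which is truncated to [0]
where [be] leaves [I], agrees with [be] at the elements it is applied to; it
does because those lie in its domains. *)
Lemma skew_inclM f g : skew_incl (f *a g) = skew_incl f *a skew_incl g.
Proof.
have skewT (h : skew ga) : coef_in (fun=> setT) h by [].
have iL := skew_incl_linear.
have i0 := linear_fun0 iL.
move: f (skewT f).
apply: coef_in_sub => [|r a Da _].
  split=> [|c f f' Hf Hf'] /=; first by rewrite !(amul0l, i0).
  by rewrite amulDl amulZl !iL Hf Hf' amulDl amulZl.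
move: g (skewT g) => /=.
apply: coef_in_sub => [|s b Db _].
  split=> [|c g g' Hg Hg'] /=; first by rewrite !(amul0r, i0).
  by rewrite amulDr amulZr !iL Hg Hg' amulDr amulZr.
rewrite /= !skew_incl_delta gdeltaM; apply: val_inj; apply/fsP => t.
rewrite [LHS]skew_inclE skew_mul_delta !singleE.
case: eqP => // _.
have Da' := pactV_in Da; have Dab := pdom_mull b Da'.
have HIr (x : subalg (ideal_subalgebra HI)) u : pdom ga u^-1%g x ->
    sval_alg (pact ga u x) = be u (sval_alg x).
  move=> Dx; apply: restr_actE.
  have JI : J u *s I `<=` I.
    by apply: sprod_sub HI.1 _ => y z _ Iz; exact: (HI.2 _ _ Iz).2.
  apply: JI.
  have -> : J u *s I = be u @` (I *s J u^-1%g).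
    by rewrite (image_sprod _ _ (gact_hom be u)) image_gactM mulgV image_gact1.
  by exists (sval_alg x).
rewrite HIr// svalM HIr ?invgK//.
by rewrite (gact_hom be r).2 gactVK.
Qed.

Lemma skew_incl_graded t f :
  gcomp (skew_graded ga) t f <-> gcomp (skew_graded al) t (skew_incl f).
Proof.
split=> [[a Da fE]|[a _ fE]].
  exists (sval_alg a) => //; apply/fsP => s.
  by rewrite skew_inclE fE !singleE; case: eqP.
exists (skew_fs f t); first exact: (submP f t).
apply/fsP => s; have [->|st] := eqVneq s t; first by rewrite single_at.
by apply: sval_inj; rewrite -skew_inclE fE !singleE (negPf st).
Qed.

Lemma range_skew_incl : range skew_incl = coef_in (fun t => I *s J t).
Proof.
apply/seteqP; split=> [_ [f _ <-] t|f Hf]; first exact: (submP f t).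
have IJI t : I *s J t `<=` I.
  by apply: sprod_sub HI.1 _ => x y Ix _; exact: (HI.2 _ _ Ix).1.
pose h t := mkalg (ideal_subalgebra HI) (IJI _ _ (Hf t)).
have hfin : fin_supp h.
  apply: (sub_finite_set _ (fs_finite (skew_fs f))) => t /= ht f0; apply: ht.
  exact: sval_inj.
have hD t : pdom ga t (mkfs hfin t) by exact: Hf.
exists (mksub (skew_submodule ga) hD) => //.
by apply: val_inj; apply/fsP.
Qed.

(** With [J t = be t @` I], the left factors in degree [1] already produce all of
[R X = X], [Y R = Y] and [Y X], the first two because [J t] and [I] are
idempotent.  Only [X Y = R] uses left factors of all degrees, and it is there
that the translates of [I] have to span. *)
Lemma restriction_graded_equivalent :
  (forall a, lspan [set x | exists t, (be t @` I) x] a) ->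
  graded_equivalent (skew_graded al) (skew_graded ga).
Proof.
move=> Itot.
have Jid t : ideal (J t) by exact: image_gact_ideal.
have JS t : submodule (J t) := (Jid t).1.
have JJ t : J t *s J t = J t.
  by rewrite -(image_sprod _ _ (gact_hom be t)) I_idem.
have IS := HI.1; have TS := @submoduleT k A.
have act1 (S : set A) : be 1%g @` S = S by exact: image_gact1.
have sub1 (U V : G -> set A) t : U 1%g *s V t `<=`
    lspan [set a | exists r, (U r *s (be r @` V (r^-1 * t)%g)) a].
  move=> a Ha; apply: sub_lspan; exists 1%g.
  by rewrite act1 invg1 mul1g.
apply: (@graded_equivalent_sub k G (skew_graded al) (skew_graded ga) skew_incl
  (coef_in (fun t => J t)) (coef_in (fun=> I))).
- by split; [exact: skew_incl_linear|exact: skew_inclM].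
- exact: skew_incl_inj.
- exact: skew_incl_graded.
- exact: coef_in_homogeneous.
- exact: coef_in_homogeneous.
- have -> : [set: skew al] = coef_in (fun=> [set: A]) by apply/seteqP.
  apply: coef_in_sprod => // [r s|t].
    rewrite image_gactM; apply: sprod_sub => // a x _ Jx.
    exact: ((Jid _).2 _ _ Jx).2.
  apply: subset_trans (sub1 (fun=> setT) (fun t => J t) t).
  by rewrite -{1}JJ; exact: sprodS.
- have -> : [set: skew al] = coef_in (fun=> [set: A]) by apply/seteqP.
  apply: coef_in_sprod => // [r s|t].
    by apply: sprod_sub => // x a Ix _; exact: (HI.2 _ _ Ix).1.
  apply: subset_trans (sub1 (fun=> I) (fun=> setT) t).
  by rewrite -{1}I_idem; exact: sprodS.
- have -> : [set: skew al] = coef_in (fun=> [set: A]) by apply/seteqP.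
  apply: coef_in_sprod => // t a _.
  (* [J r] occurs as [U r * be_r(V s)], being [J r * be_r(I)]. *)
  have := Itot a; move: a; apply: lspan_sub; first exact: submodule_lspan.
  by move=> a [r Ja]; apply: sub_lspan; exists r; rewrite JJ.
- rewrite range_skew_incl; apply: coef_in_sprod => // [t|r s|t].
  + exact: submodule_sprod.
  + by rewrite image_gactM.
  + exact: sub1 (fun=> I) (fun t => J t) t.
Qed.

End Globalization.

(** * The partial smash product *)

(** An element with a single nonzero entry, in row [r], lies in the translate by
[r]: moved back by [r^-1] it sits in row [1], where the entries of the ideal are
those in [B_1 B_s = B_s]. *)
Lemma psmash_translates_span (k : comPzRingType) (G : groupType)
    (B : gradedAlg k G) : partially_strongly_graded B ->
  forall a : smash B,
    lspan [set x | exists t, (smash_action B t @` @psmash k G B) x] a.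
Proof.
move=> hB a.
have BS := gcomp_submodule B.
apply: (smash_sum_in (submodule_lspan _)
  (fun r s => BS (r^-1 * s)%g)) => [|r s].
  move=> r s x Bx _; apply: sub_lspan; exists r.
  exists (smash_act r^-1%g (smash_single Bx)); last exact: (gactVK (smash_action B)).
  have Bx' : gcomp B ((r^-1 * r)^-1 * (r^-1 * s))%g x by rewrite mulVg invg1 mul1g.
  rewrite (smash_act_single Bx Bx').
  apply: (entry_single Bx' (S := fun r s => gcomp B r^-1%g *s gcomp B s)) => [r' s'|].
    exact: submodule_sprod.
  rewrite mulVg invg1.
  (* [B_u = (B_u B_(u^-1)) B_u], and [B_u B_(u^-1)] is contained in [B_1]. *)
  move: Bx => {Bx'}; rewrite [X in X x -> _]hB; move: x; apply: sprodS => //.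
  apply: subset_trans (@gcomp_mul _ _ B _ _) _.
  by rewrite mulgV.
exact: entryP.
Qed.

Theorem theorem6p5 (k : comPzRingType) (G : groupType) (B : gradedAlg k G)
    (hB : partially_strongly_graded B) :
  graded_equivalent (skew_graded (smash_pact hB)) (skew_graded (canonical_pact hB)).
Proof.
exact: restriction_graded_equivalent (psmash_translates_span hB).
Qed.
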